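(* On cycles with $n$ vertices, $k$-PVCR can be solved in $O(n)$ time under each of $\mathsf{TJ}$ and $\mathsf{TAR}(u)$, and in $O(n^2)$ time under $\mathsf{TS}$.
   Context: Fix an integer $k \geq 2$. A $k$-path is a path on $k$ vertices. A vertex subset $I \subseteq V(G)$ is a $k$-path vertex cover of $G$ if every $k$-path in $G$ contains at least one vertex of $I$. A sequence $\langle I_0, \dots, I_\ell \rangle$ of $k$-path vertex covers of $G$ is: a $\mathsf{TS}$-sequence if for each $i<\ell$ there are vertices $x_i,y_i$ with $I_i \setminus I_{i+1} = \{x_i\}$, $I_{i+1}\setminus I_i = \{y_i\}$ and $x_iy_i \in E(G)$; a $\mathsf{TJ}$-sequence if the same holds without requiring $x_iy_i \in E(G)$; a $\mathsf{TAR}(u)$-sequence, for a positive integer $u$, if $|I_i| \le u$ for all $i$ and $|I_i \Delta I_{i+1}| = 1$ for each $i<\ell$. The problem $k$-PVCR under rule $\mathsf{R}$: given a graph $G$ and two distinct $k$-path vertex covers $I,J$ of $G$ (and, for $\mathsf{TAR}(u)$, the positive integer $u$), decide whether an $\mathsf{R}$-sequence between $I$ and $J$ exists. *)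

(* Defs.v *)
From mathcomp Require Import all_boot.
Set Implicit Arguments. Unset Strict Implicit. Unset Printing Implicit Defensive.

Definition is_kpath (T : finType) (e : rel T) (k : nat) (p : seq T) : bool :=
  [&& size p == k, uniq p &
      match p with x :: s => path e x s | [::] => true end].

Definition is_kpvc (T : finType) (e : rel T) (k : nat) (I : {set T}) : Prop :=
  forall p : seq T, is_kpath e k p -> has (fun x => x \in I) p.

Definition symdiff (T : finType) (A B : {set T}) : {set T} :=
  (A :\: B) :|: (B :\: A).

Definition TS_step (T : finType) (e : rel T) (A B : {set T}) : Prop :=
  exists x y, A :\: B = [set x] /\ B :\: A = [set y] /\ e x y.

Definition TJ_step (T : finType) (A B : {set T}) : Prop :=
  exists x y, A :\: B = [set x] /\ B :\: A = [set y].

(* One step under token addition/removal (the size bound |I_i| <= u is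
   imposed on every member of the sequence in TAR_reach below). *)
Definition TAR_step (T : finType) (A B : {set T}) : Prop :=
  #|symdiff A B| = 1.

Definition reconf (T : finType) (e : rel T) (k : nat)
  (Q : {set T} -> Prop) (R : {set T} -> {set T} -> Prop) (I J : {set T}) : Prop :=
  exists s : seq {set T},
    [/\ s != [::], head set0 s = I, last set0 s = J,
        (forall i, i < size s -> is_kpvc e k (nth set0 s i) /\ Q (nth set0 s i)) &
        (forall i, i.+1 < size s -> R (nth set0 s i) (nth set0 s i.+1))].

Definition TS_reach (T : finType) (e : rel T) k (I J : {set T}) : Prop :=
  reconf e k (fun _ => True) (@TS_step T e) I J.
Definition TJ_reach (T : finType) (e : rel T) k (I J : {set T}) : Prop :=
  reconf e k (fun _ => True) (@TJ_step T) I J.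
Definition TAR_reach (T : finType) (e : rel T) k (u : nat) (I J : {set T}) : Prop :=
  reconf e k (fun A => #|A| <= u) (@TAR_step T) I J.

Definition cycle_adj (n : nat) : rel 'I_n :=
  fun i j => (val j == (val i).+1 %% n) || (val i == (val j).+1 %% n).

(* A unit-cost RAM model (registers = memory cells, indexed by nat,    *)
(* holding naturals, zero-initialized outside the input).              *)

Inductive instr : Type :=
| Const of nat & nat
| Add of nat & nat & nat
| Sub of nat & nat & nat    (* Sub d a b   : M[d] := M[a] - M[b] (trunc)*)
| LoadI of nat & nat
| StoreI of nat & nat
| Jz of nat & nat
| Jmp of nat
| Halt.

Definition program := seq instr.
Definition config : Type := (nat * (nat -> nat))%type.

Definition upd (M : nat -> nat) (a v : nat) : nat -> nat :=
  fun x => if x == a then v else M x.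

(* The current instruction; falling off the program counts as Halt. *)
Definition cur (P : program) (c : config) : instr := nth Halt P c.1.

Definition halted (P : program) (c : config) : bool :=
  if cur P c is Halt then true else false.

Definition step (P : program) (c : config) : config :=
  let: (pc, M) := c in
  match nth Halt P pc with
  | Const d v => (pc.+1, upd M d v)
  | Add d a b => (pc.+1, upd M d (M a + M b))
  | Sub d a b => (pc.+1, upd M d (M a - M b))
  | LoadI d a => (pc.+1, upd M d (M (M a)))
  | StoreI a s => (pc.+1, upd M (M a) (M s))
  | Jz r t => (if M r == 0 then t else pc.+1, M)
  | Jmp t => (t, M)
  | Halt => (pc, M)
  end.

Definition exec (P : program) (t : nat) (c : config) : config := iter t (step P) c.

Definition decides_within (P : program) (t : nat) (M0 : nat -> nat) (b : Prop) : Prop :=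
  let c := exec P t (0, M0) in
  halted P c /\ c.2 0 <= 1 /\ (c.2 0 = 1 <-> b).

Definition in_set_nat n (A : {set 'I_n}) (i : nat) : bool :=
  [exists x : 'I_n, (val x == i) && (x \in A)].

Definition encode (n u : nat) (I J : {set 'I_n}) : nat -> nat :=
  fun a =>
    if a == 1 then n
    else if a == 2 then u
    else if (3 <= a) && (a < 3 + n) then nat_of_bool (in_set_nat I (a - 3))
    else if (3 + n <= a) && (a < 3 + n + n) then nat_of_bool (in_set_nat J (a - 3 - n))
    else 0.
Arguments encode n u I J : clear implicits.

(* Main.v *)
Require Import Defs.
From mathcomp Require Import all_boot.
From mathcomp Require Import zify.
Set Implicit Arguments. Unset Strict Implicit. Unset Printing Implicit Defensive.

(* Let s = |I|.  Token sliding and token jumping have the same reachability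
   relation on cycles: I and J are connected iff |I| = |J| and not (k s = n and
   s > 1).  If k s = n then every window of k vertices contains exactly one
   token, so I is k-periodic and, as soon as s > 1, rigid.  Otherwise encode a
   cover as the height function h(x) = c + #(tokens in [0, x)) of its periodic
   lift, which climbs by 0 or 1 per step and by s per turn.  Sliding the token
   at x to x+1 lowers h at x+1.  If g <= h are heights of two covers and
   g < h somewhere, then h can be lowered at a site where g < h: blocked sites
   lead to blocked sites k steps to the left, and going around k times would
   give k s = n.  Hence sliding always brings h down to g.

   Under TAR(u), I and J are connected as soon as I /\ J is a cover (or k > n).
   Otherwise both must admit the removal of a token when they have size u, and
   then can be padded to size u - 1 and connected by jumps, except if
   k (u - 1) = n and u > 2, where I determines the unique minimum cover inside
   it and this cover never changes.

   All these conditions are read off two passes over the cyclic word by a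
   bounded number of counters: a token of a cover is removable iff three tokens
   lie within distance k, and a set is no cover iff it leaves k consecutive
   vertices free. *)

(** * Reconfiguration sequences *)

Section Reconf.
Variables (T : finType) (e : rel T) (k : nat).
Variables (Q : {set T} -> Prop) (R : {set T} -> {set T} -> Prop).
Implicit Types A B C : {set T}.

Local Notation ok A := (is_kpvc e k A /\ Q A).
Local Notation reach := (reconf e k Q R).

Lemma reconf_refl A : ok A -> reach A A.
Proof. by move=> okA; exists [:: A]; split=> // -[]. Qed.

Lemma reconf_cons A B C : ok A -> R A B -> reach B C -> reach A C.
Proof.
move=> okA RAB [[|B' s] [] // _ /= EB EC oks Rs]; subst B'.
exists [:: A, B & s]; split=> //; first by case.
by case.
Qed.

(** Induction along the sequence with its target [C] fixed; it spares later proofs the handling of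
    lists and indices. *)
Lemma reconf_rev_ind (P : {set T} -> Prop) C :
  (ok C -> P C) ->
  (forall A B, ok A -> R A B -> reach B C -> P B -> P A) ->
  forall A, reach A C -> P A.
Proof.
move=> P0 PS A [s [+ + + + +]].
elim: s A => [//|A' s IH] A _ /= EA EC oks Rs; subst A'.
case: s IH EC oks Rs => [|B s] IH /= EC oks Rs.
  by rewrite EC; apply: P0; rewrite -EC; apply: (oks 0).
have reachB : reach B C.
  exists (B :: s); split=> // i Hi; first exact: (oks i.+1).
  exact: (Rs i.+1).
apply: (PS A B) => //; [exact: (oks 0) | exact: (Rs 0)|].
by apply: IH => // i Hi; [apply: (oks i.+1) | apply: (Rs i.+1)].
Qed.

Lemma reconf_okl A B : reach A B -> ok A.
Proof. by move: A; apply: reconf_rev_ind. Qed.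

Lemma reconf_trans A B C : reach A B -> reach B C -> reach A C.
Proof.
move=> rAB rBC; move: A rAB; apply: reconf_rev_ind => // A A' okA RAA' _.
exact: reconf_cons.
Qed.

Lemma reconf_inv (P : {set T} -> Prop) :
  (forall A B, ok A -> ok B -> R A B -> P A -> P B) ->
  forall A B, reach A B -> P A -> P B.
Proof.
move=> PS A B; move: A; apply: reconf_rev_ind => // A A' okA RAA' rA' IH PA.
by apply: IH; apply: PS PA => //; apply: reconf_okl rA'.
Qed.

Lemma reconf_okr A B : reach A B -> ok B.
Proof.
move=> rAB; apply: (reconf_inv (P := fun B => ok B) _ rAB) => //.
exact: reconf_okl rAB.
Qed.

Lemma reconf_sym : (forall A B, R A B -> R B A) ->
  forall A B, reach A B -> reach B A.
Proof.
move=> symR A B rAB; have okA := reconf_okl rAB.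
apply: (reconf_inv (P := fun B => reach B A) _ rAB); last exact: reconf_refl.
by move=> C D okC okD RCD; apply: reconf_cons => //; apply: symR.
Qed.
End Reconf.

Lemma kpvc_sub (T : finType) (e : rel T) k (A B : {set T}) :
  A \subset B -> is_kpvc e k A -> is_kpvc e k B.
Proof. by move=> /subsetP sAB H p /H; apply: sub_has. Qed.

(** * Heights of periodic words *)

(** Reading positions modulo [n] gives an [n]-periodic word, in which arcs of the cycle become
    intervals of naturals. *)
Definition tok n (A : {set 'I_n}) (x : nat) : bool := in_set_nat A (x %% n).

Definition cov k (b : nat -> bool) : Prop := forall x, exists2 j, j < k & b (x + j).

Definition cnt (b : nat -> bool) (x : nat) : nat := \sum_(j < x) b j.

Section Tokens.
Variable n : nat.
Implicit Type A B : {set 'I_n}.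

Lemma in_set_natE A (i : 'I_n) : in_set_nat A i = (i \in A).
Proof.
apply/existsP/idP => [[x /andP[/eqP/val_inj-> //]]|iA].
by exists i; rewrite eqxx.
Qed.

Lemma tok_val A (i : 'I_n) : tok A i = (i \in A).
Proof. by rewrite /tok modn_small // in_set_natE. Qed.

Lemma tok_mod A x : tok A (x %% n) = tok A x.
Proof. by rewrite /tok modn_mod. Qed.

Lemma tok_per A x : tok A (x + n) = tok A x.
Proof. by rewrite /tok modnDr. Qed.

Lemma tok_perM A x m : tok A (x + m * n) = tok A x.
Proof. by rewrite /tok addnC modnMDl. Qed.

Lemma tok_in A x (x_n : x %% n < n) : tok A x = (Ordinal x_n \in A).
Proof. by rewrite -tok_val tok_mod. Qed.

End Tokens.

Lemma cntS b x : cnt b x.+1 = cnt b x + b x.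
Proof. by rewrite /cnt big_ord_recr. Qed.

Lemma cntD b x m : cnt b (x + m) = cnt b x + cnt (fun j => b (x + j)) m.
Proof.
elim: m => [|m IH]; first by rewrite /cnt big_ord0 !addn0.
by rewrite addnS !cntS IH addnA.
Qed.

Lemma cnt_gt0 b m : (0 < cnt b m) <-> (exists2 j, j < m & b j).
Proof.
elim: m => [|m [IH1 IH2]]; first by rewrite /cnt big_ord0; split=> // -[].
rewrite cntS; split.
  case: (boolP (b m)) => [bm _|_]; first by exists m.
  by rewrite addn0 => /IH1[j lt_j bj]; exists j => //; apply: ltnW.
case=> j; rewrite ltnS leq_eqVlt => /predU1P[-> -> |lt_j bj]; first by rewrite addn1.
by rewrite ltn_addr // IH2 //; exists j.
Qed.

Lemma cov_cnt k b : cov k b <-> forall x, cnt b x < cnt b (x + k).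
Proof.
split=> H x; have := H x; rewrite cntD -{1}[cnt b x]addn0 ltn_add2l;
by move/(cnt_gt0 (fun j => b (x + j)) k).
Qed.

Lemma cnt_card n (A : {set 'I_n}) : cnt (tok A) n = #|A|.
Proof.
rewrite -sum1_card /cnt [RHS]big_mkcond /=; apply: eq_bigr => i _.
by rewrite tok_val; case: (i \in A).
Qed.

(** The value at 0 is left free: adding a constant moves no token, and lets the height of one cover
    be placed above that of another. *)
Definition height (n s : nat) (h : nat -> nat) : Prop :=
  (forall x, h (x + n) = h x + s) /\ (forall x, h x <= h x.+1 <= (h x).+1).

Lemma height_cnt n (A : {set 'I_n}) : height n #|A| (cnt (tok A)).
Proof.
split=> x; last by rewrite cntS leq_addr /= -addn1 leq_add2l leq_b1.
elim: x => [|x IH]; first by rewrite add0n cnt_card /cnt big_ord0.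
by rewrite addSn !cntS IH tok_per addnAC.
Qed.

Lemma height_perM n s h m x : height n s h -> h (x + m * n) = h x + m * s.
Proof.
case=> per _; elim: m => [|m IH]; first by rewrite !addn0.
by rewrite !mulSn [n + _]addnC addnA per IH; lia.
Qed.

Lemma height_mod n s h x : height n s h -> h x = h (x %% n) + x %/ n * s.
Proof. by move=> hh; rewrite -(height_perM _ _ hh) addnC -divn_eq. Qed.

Lemma height_mono n s h x m : height n s h -> h x <= h (x + m) <= h x + m.
Proof.
case=> _ st; elim: m => [|m IH]; first by rewrite !addn0 leqnn.
by have := st (x + m); rewrite !addnS; lia.
Qed.

Definition set_of n (h : nat -> nat) : {set 'I_n} := [set i : 'I_n | h i < h i.+1].

Lemma tok_set_of n s h x : 0 < n -> height n s h -> tok (set_of n h) x = (h x < h x.+1).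
Proof.
move=> n0 hh; have x_n : x %% n < n by rewrite ltn_mod.
have E : x.+1 = (x %% n).+1 + x %/ n * n by rewrite addSn addnC -divn_eq.
by rewrite (tok_in _ x_n) inE /= (height_mod x hh) E (height_perM _ _ hh) ltn_add2r.
Qed.

Lemma cnt_tok_set_of n s h x : 0 < n -> height n s h ->
  h 0 + cnt (tok (set_of n h)) x = h x.
Proof.
move=> n0 hh; elim: x => [|x IH]; first by rewrite /cnt big_ord0 addn0.
rewrite cntS addnA IH (tok_set_of _ n0 hh).
by case: hh => _ /(_ x); case: ltnP => /=; lia.
Qed.

Lemma set_of_cnt n (A : {set 'I_n}) c : set_of n (fun x => cnt (tok A) x + c) = A.
Proof.
apply/setP=> i; rewrite inE cntS tok_val ltn_add2r -{1}[cnt _ _]addn0 ltn_add2l.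
by case: (i \in A).
Qed.

(** * Lowering one height function to another by slides *)

Section Slide.
Variables (n s k : nat).
Hypotheses (n2 : 1 < n) (k2 : 1 < k) (s0 : 0 < s) (sn : s < n) (skn : k * s <> n).


(** The site can be pushed: [y] holds a token, [y.+1] is free, and by the last conjunct the window
    ending at [y] has a second token, so it survives the loss. *)
Lemma exists_free_site h g x0 :
    height n s h -> height n s g ->
    (forall x, h x < h (x + k)) -> (forall x, g x < g (x + k)) ->
    (forall x, g x <= h x) -> g x0 < h x0 ->
  exists y, [/\ k <= y.+1, g y.+1 < h y.+1, h y < h y.+1, h y.+2 = h y.+1 &
                (h (y.+1 - k)).+1 < h y.+1].
Proof.
move=> hh gg hk gk le_gh lt0.
have hS x : h x <= h x.+1 <= (h x).+1 by case: hh => _; apply.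
have gS x : g x <= g x.+1 <= (g x).+1 by case: gg => _; apply.
have gk1 x : g x + 1 <= g (x + k) by rewrite addn1.
(* Far enough to the right that going left by one turn and then [n] times by [k] stays among the
   naturals. *)
have [x [lt1 le1]] : exists x, g x < h x /\ n * k + n + k <= x.
  exists (x0 + (n * k + n + k) * n).
  rewrite (height_perM _ _ hh) (height_perM _ _ gg) ltn_add2r; split=> //.
  by apply: leq_trans (leq_addl _ _); apply: leq_pmulr; lia.
(* Going left while [h] is constant keeps [g < h], as [g] can only drop; a token is met within one
   turn because [s > 0]. *)
have [y [lty tok_y le_y]] : exists y, [/\ g y.+1 < h y.+1, h y < h y.+1 & n * k + k <= y].
  have left m : m <= n -> h (x - m) = h x \/
      exists y, [/\ g y.+1 < h y.+1, h y < h y.+1 & n * k + k <= y].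
    elim: m => [|m IH] le_m; first by left; rewrite subn0.
    case: IH => [|Em|]; [exact: ltnW | | by right].
    have Ex : (x - m.+1).+1 = x - m by lia.
    have := hS (x - m.+1); rewrite Ex Em => hSx.
    have := height_mono (x - m) m gg; rewrite subnK => [gx|]; last lia.
    case: (ltnP (h (x - m.+1)) (h x)) => lt_h; [right | left]; last by lia.
    by exists (x - m.+1); rewrite Ex Em; split=> //; lia.
  case: (left n) => // En; have [per _] := hh; have := per (x - n).
  by rewrite subnK; lia.
(* [P y]: [y] is the right end of a block of tokens and [g < h] right after it. *)
pose P y := [/\ g y.+1 < h y.+1, h y < h y.+1 & h y.+2 = h y.+1].
(* Along the block [h] climbs at full speed, so [g] cannot catch up; the block ends within one turn
   because [s < n]. *)
have [z [Pz le_z]] : exists z, P z /\ n * k + k <= z.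
  have right m : (exists z, P z /\ n * k + k <= z) \/
      [/\ h (y + m).+1 = h y + m.+1, g (y + m).+1 < h (y + m).+1 & h (y + m) < h (y + m).+1].
    elim: m => [|m [IH|[E1 E2 E3]]]; [right | by left | ].
      by rewrite addn0; split=> //; have := hS y; lia.
    have := hS (y + m).+1; have := gS (y + m).+1; rewrite addnS => gSx hSx.
    case: (ltnP (h (y + m).+1) (h (y + m).+2)) => lt_h; [right | left].
      by split=> //; lia.
    by exists (y + m); split; [split=> //; lia | lia].
  case: (right n.-1) => // -[E _ _]; have [per _] := hh; have := per y.
  have -> : y + n = (y + n.-1).+1 by lia.
  by rewrite E; lia.
(* A blocked right end forces the next window to the left to hold one token only. *)
have down m : m <= n ->
    (exists y, [/\ k <= y.+1, P y & (h (y.+1 - k)).+1 < h y.+1]) \/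
    (P (z - m * k) /\ h (z - m * k).+1 + m = h z.+1).
  elim: m => [|m IH] le_m; first by right; rewrite subn0 addn0.
  case: IH => [|H|[Pm Em]]; [exact: ltnW | by left | ].
  set y' := z - m * k in Pm Em *.
  have le_mk : m.+1 * k <= n * k by rewrite leq_mul2r le_m orbT.
  have Ey' : y' = z - m.+1 * k + k by rewrite /y' mulSn in le_mk *; lia.
  case: (ltnP (h (y'.+1 - k)).+1 (h y'.+1)) => lt_h.
    by left; exists y'; split=> //; lia.
  right; set w := z - m.+1 * k in Ey' *.
  have Ew : y'.+1 - k = w.+1 by lia.
  rewrite Ew in lt_h; case: Pm => P1 P2 P3.
  (* The window ending at [y'] has [y'] as its only token, so [h] is constant from [w.+1] to [y'],
     and covering the window at [w] forces a token at [w]. As [g] gains at least 1 over [k] steps,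
     [g < h] holds at [w.+1]. *)
  have h1 := hk w; have h2 := hk w.+1; have h3 := hk w.+2.
  have g2 := gk w.+1; have m1 := height_mono w.+2 (k - 2) hh.
  have Ek : w.+2 + (k - 2) = y' by lia.
  rewrite Ek in m1; rewrite -Ey' in h1; rewrite addSn -Ey' in h2 g2.
  have := hS w; have := hS w.+1; have := hS y'; have := gS w => *.
  by split; [split|]; lia.
case: (down n) => // [[y' [? [? ? ?] ?]]|[_ E]]; first by exists y'.
(* [n] steps of length [k] make [k] turns: [h] drops by [n] along the descent, and by [k * s] by
   periodicity. *)
case: skn; have := height_perM k (z - n * k).+1 hh.
have -> : (z - n * k).+1 + k * n = z.+1 by lia.
by rewrite -E => /addnI.
Qed.

Lemma height_eqmod h y x : height n s h -> y = x %[mod n] ->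
  forall j, h (y + j) + x %/ n * s = h (x + j) + y %/ n * s.
Proof.
move=> hh E j; rewrite -!(height_perM _ _ hh) [y + j]addnC [x + j]addnC -!addnA.
by rewrite {1}(divn_eq y n) {2}(divn_eq x n) E; congr (h (j + _)); lia.
Qed.

(* The move of a token from [x] to [x.+1], modulo [n]. *)
Definition push (h : nat -> nat) (x : nat) : nat -> nat :=
  fun y => h y - (y == x.+1 %[mod n]).

Lemma modS_neq y x : y = x %[mod n] -> (y == x.+1 %[mod n]) = false.
Proof.
move=> E; apply/negP; rewrite E -[x in (x %% n)]addn0 -addn1 eqn_modDl.
by rewrite mod0n modn_small.
Qed.

Lemma eqmodS y x : (y.+1 == x.+1 %[mod n]) = (y == x %[mod n]).
Proof. by rewrite -[y.+1]addn1 -[x.+1]addn1 eqn_modDr. Qed.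

Section Push.
Variables (h : nat -> nat) (x : nat).
Hypotheses (hh : height n s h) (tok_x : h x < h x.+1) (free_x : h x.+2 = h x.+1).
(** [push] subtracts with truncation; positivity makes it a true decrement. *)
Hypothesis hpos : forall y, y = x.+1 %[mod n] -> 0 < h y.

Lemma tok_eqmod y : y = x %[mod n] -> h y < h y.+1.
Proof.
move=> E; have := height_eqmod hh E 0; have := height_eqmod hh E 1.
by rewrite !addn0 !addn1; lia.
Qed.

Lemma free_eqmod y : y = x.+1 %[mod n] -> h y.+1 = h y.
Proof.
move=> E; have := height_eqmod hh E 0; have := height_eqmod hh E 1.
by rewrite !addn0 !addn1; lia.
Qed.

Lemma height_push : height n s (push h x).
Proof.
have [per st] := hh; rewrite /push; split=> y.
  rewrite modnDr per; case: eqP => [/hpos|_]; lia.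
rewrite eqmodS; case: (eqVneq (y %% n) (x %% n)) => [E|_].
  by rewrite (modS_neq E); have := st y; have := tok_eqmod E; lia.
case: eqP => [E|_]; last by have := st y; lia.
by have := hpos E; rewrite free_eqmod //; lia.
Qed.

Lemma TS_push : TS_step (@cycle_adj n) (set_of n h) (set_of n (push h x)).
Proof.
have x_n : x %% n < n by rewrite ltn_mod; lia.
have xS_n : x.+1 %% n < n by rewrite ltn_mod; lia.
have [per st] := hh.
have eq_val_mod (i : 'I_n) y : (i == y %% n :> nat) = (i == y %[mod n]).
  by rewrite [in RHS](modn_small (ltn_ord i)).
exists (Ordinal x_n), (Ordinal xS_n); split; last split; last first.
- by rewrite /cycle_adj /= -[(x %% n).+1]addn1 modnDml addn1 eqxx.
- apply/setP=> i; rewrite !inE -val_eqE /= /push eqmodS.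
  rewrite eq_val_mod.
  case: (eqVneq (i %% n) (x %% n)) => [E|_].
    by rewrite (modS_neq E) (tok_eqmod E).
  case: eqP => [E|_]; last by rewrite !subn0 andNb.
  by have := hpos E; rewrite (free_eqmod E) ltnn subn0; lia.
- apply/setP=> i; rewrite !inE -val_eqE /= /push eqmodS.
  rewrite eq_val_mod.
  case: (eqVneq (i %% n) (x %% n)) => [E|_].
    by rewrite (modS_neq E) (tok_eqmod E); have := st i; lia.
  case: eqP => [E|_]; last by rewrite !subn0 andNb.
  by rewrite (free_eqmod E) ltnn andbF.
Qed.

(** Only windows that end just before [x.+1] modulo [n] can lose a token, and the last hypothesis
    gives these at least two. *)
Lemma push_window : (forall y, h y < h (y + k)) -> k <= x.+1 ->
  (h (x.+1 - k)).+1 < h x.+1 -> forall y, push h x y < push h x (y + k).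
Proof.
move=> hk le_k big y; rewrite /push.
case: (eqVneq ((y + k) %% n) (x.+1 %% n)) => [E|_]; last first.
  by rewrite subn0; apply: leq_ltn_trans (leq_subr _ _) (hk y).
have E' : y = x.+1 - k %[mod n].
  by apply/eqP; rewrite -(eqn_modDr k) subnK // E.
have := height_eqmod hh E' 0; have := height_eqmod hh E' k.
by rewrite !addn0 subnK //; lia.
Qed.
End Push.

(** The window length [k] is kept apart from the path length [kk] because a single token with
    [kk = n] is treated with the longer window [n.+1]. The induction is on the sum of [h] over one
    turn, which every push lowers. *)
Lemma slide kk h g :
    (forall h', height n s h' -> (forall x, h' x < h' (x + k)) ->
       is_kpvc (@cycle_adj n) kk (set_of n h')) ->
    height n s h -> height n s g ->
    (forall x, h x < h (x + k)) -> (forall x, g x < g (x + k)) ->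
    (forall x, g x <= h x) ->
  TS_reach (@cycle_adj n) kk (set_of n h) (set_of n g).
Proof.
move=> valid hh gg hk gk le_gh.
have [m] := ubnP (\sum_(i < n) h i); elim: m h hh hk le_gh => // m IH h hh hk le_gh lt_m.
case: (boolP [exists i : 'I_n, g i < h i]) => [/existsP[i lt_i]|]; last first.
  rewrite negb_exists => /forallP H.
  have E x : h x = g x.
    rewrite (height_mod x hh) (height_mod x gg); congr (_ + _).
    have x_n : x %% n < n by rewrite ltn_mod; lia.
    by apply/eqP; rewrite eqn_leq le_gh andbT leqNgt; apply: (H (Ordinal x_n)).
  have -> : set_of n h = set_of n g by apply/setP=> j; rewrite !inE !E.
  by apply: reconf_refl; split=> //; apply: valid.
have [x [le_k lt_x tok_x free_x big]] := exists_free_site hh gg hk gk le_gh lt_i.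
have lt_eqmod y : y = x.+1 %[mod n] -> g y < h y.
  move=> E; have := height_eqmod hh E 0; have := height_eqmod gg E 0.
  by rewrite !addn0; lia.
have hpos y : y = x.+1 %[mod n] -> 0 < h y by move/lt_eqmod; lia.
apply: reconf_cons (TS_push hh tok_x free_x hpos) _; first by split=> //; apply: valid.
apply: IH.
- exact: height_push.
- exact: push_window.
- move=> y; rewrite /push; case: eqP => [/lt_eqmod|_]; last by rewrite subn0.
  by lia.
- have x_n : x.+1 %% n < n by rewrite ltn_mod; lia.
  rewrite -ltnS; apply: leq_trans lt_m; rewrite ltnS.
  rewrite (bigD1 (Ordinal x_n)) //= [X in _ < X](bigD1 (Ordinal x_n)) //=.
  rewrite -addSn leq_add //; last by apply: leq_sum => j _; apply: leq_subr.
  by rewrite /push modn_mod eqxx; have := hpos (x.+1 %% n) (modn_mod _ _); lia.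
Qed.
End Slide.

(** * Token sliding and token jumping on cycles *)

Lemma TJ_step_card (T : finType) (A B : {set T}) : TJ_step A B -> #|A| = #|B|.
Proof.
by case=> x [y [Ax By]]; rewrite -(cardsID B A) -(cardsID A B) Ax By !cards1 setIC.
Qed.

Lemma TS_TJ_reach (T : finType) (e : rel T) k (I J : {set T}) :
  TS_reach e k I J -> TJ_reach e k I J.
Proof.
move: I; apply: reconf_rev_ind => [ok|A B okA [x [y [Ax [By _]]]] _ rB].
  exact: reconf_refl.
by apply: reconf_cons rB => //; exists x, y.
Qed.

Section Cycle.
Variables (n k : nat).
Hypotheses (n3 : 2 < n) (k2 : 1 < k).
Implicit Types A B I J : {set 'I_n}.
Local Notation adj := (@cycle_adj n).

Lemma kpvc_big A : n < k -> is_kpvc adj k A.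
Proof.
move=> lt_nk p /and3P[/eqP sz up _].
by have := max_card (mem p); rewrite (card_uniqP up) card_ord sz leqNgt lt_nk.
Qed.

Lemma mod_run (u : nat -> nat) m : u 0 < n ->
  (forall j, j.+1 < m -> u j.+1 = (u j).+1 %% n) ->
  forall j, j < m -> u j = (u 0 + j) %% n.
Proof.
move=> u0 uS; elim=> [|j IH] lt_j; first by rewrite addn0 modn_small.
by rewrite uS // IH ?(ltnW lt_j) // -addn1 modnDml addn1 addnS.
Qed.

Lemma succ_mod_inj x y : x < n -> y < n -> x.+1 %% n = y.+1 %% n -> x = y.
Proof.
move=> xn yn /eqP; rewrite -[x.+1]addn1 -[y.+1]addn1 eqn_modDr.
by rewrite !modn_small // => /eqP.
Qed.

(** Neighbours differ by 1 modulo [n], and turning back would repeat a vertex, so the first step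
    fixes the direction of the whole path. *)
Lemma kpath_arc x0 (p : seq 'I_n) : is_kpath adj k p ->
  (forall j, j < k -> val (nth x0 p j) = (nth x0 p 0 + j) %% n) \/
  (forall j, j < k -> val (nth x0 p (k.-1 - j)) = (nth x0 p k.-1 + j) %% n).
Proof.
case/and3P=> /eqP sz up ep.
pose v j := val (nth x0 p j).
have v_n j : v j < n by apply: ltn_ord.
have v_adj j : j.+1 < k -> v j.+1 = (v j).+1 %% n \/ v j = (v j.+1).+1 %% n.
  rewrite /v -sz; case: p ep {sz up v v_n} => [//|x p] /= /(pathP x0) ep lt_j.
  by case/orP: (ep j lt_j) => /eqP->; [left | right].
have v_inj i j : i < k -> j < k -> v i = v j -> i = j.
  move=> lt_i lt_j /val_inj/eqP.
  by rewrite nth_uniq ?sz // => /eqP.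
case: (v_adj 0 k2) => E0; [left | right].
  move=> j lt_j; apply: (@mod_run v k) => // {j lt_j}.
  elim=> [//|j IH] lt_j; case: (v_adj j.+1) => // E.
  have := succ_mod_inj (v_n _) (v_n _) (etrans (esym (IH (ltnW lt_j))) E).
  by move/v_inj => /(_ (ltnW (ltnW lt_j)) lt_j); lia.
have bwd : forall j, j.+1 < k -> v j = (v j.+1).+1 %% n.
  elim=> [//|j IH] lt_j; case: (v_adj j.+1) => // E.
  have := etrans E (esym (IH (ltnW lt_j))).
  by move/v_inj => /(_ lt_j (ltnW (ltnW lt_j))); lia.
have := @mod_run (fun j => v (k.-1 - j)) k; rewrite subn0 /=; apply=> // j lt_j.
have -> : k.-1 - j = (k.-1 - j.+1).+1 by lia.
by apply: bwd; lia.
Qed.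

(** By [kpath_arc] a path is an arc of [k] vertices in one of two directions; [k <= n] makes the
    vertices of each arc distinct. *)
Lemma kpvc_cov A : k <= n -> is_kpvc adj k A <-> cov k (tok A).
Proof.
move=> le_kn; have n0 : 0 < n by lia.
have md x : x %% n < n by rewrite ltn_mod.
split=> [HA x|cA p pp].
  pose f j : 'I_n := Ordinal (md (x + j)).
  have : is_kpath adj k [seq f j | j <- iota 0 k].
    apply/and3P; split; first by rewrite size_map size_iota.
      rewrite map_inj_in_uniq ?iota_uniq // => i j.
      rewrite !mem_iota !add0n /= => lt_i lt_j [] /eqP.
      by rewrite eqn_modDl !modn_small ?(leq_trans _ le_kn) // => /eqP.
    case: (k) => [//|k'] /=; apply/(pathP (f 0)) => j.
    rewrite size_map size_iota => lt_j.
    rewrite -(map_cons f 0) !(nth_map 0) ?size_iota //=; last by rewrite size_iota ltnW.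
    rewrite -[0 :: _]/(iota 0 k'.+1) !nth_iota // ?add1n ?add0n; last exact: ltnW.
    by rewrite /cycle_adj /= -[((x + j) %% n).+1]addn1 modnDml addn1 addnS eqxx.
  case/HA/hasP => y /mapP[j]; rewrite mem_iota => /andP[_ lt_j] -> fA.
  by exists j => //; rewrite (tok_in _ (md _)).
have [/eqP sz _ _] := and3P pp.
case: p pp sz => [|x0 p] pp sz; first by move: k2; rewrite -sz.
case: (kpath_arc x0 pp) => H.
  have [j lt_j] := cA (nth x0 (x0 :: p) 0).
  rewrite (tok_in _ (md _)) => jA; apply/hasP; exists (nth x0 (x0 :: p) j).
    by rewrite mem_nth // sz.
  by rewrite (_ : nth _ _ _ = Ordinal (md (nth x0 (x0 :: p) 0 + j))) //; apply: val_inj; rewrite H.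
have [j lt_j] := cA (nth x0 (x0 :: p) k.-1).
rewrite (tok_in _ (md _)) => jA; apply/hasP; exists (nth x0 (x0 :: p) (k.-1 - j)).
  by rewrite mem_nth // sz; lia.
by rewrite (_ : nth _ _ _ = Ordinal (md (nth x0 (x0 :: p) k.-1 + j))) //; apply: val_inj; rewrite H.
Qed.

Lemma height_long s h m x : n <= m -> 0 < s -> height n s h -> h x < h (x + m).
Proof.
move=> le_nm s0 hh; have := height_mono (x + n) (m - n) hh.
by rewrite -addnA subnKC // (proj1 hh); lia.
Qed.

(** Distinct sets of equal size have neither 0 nor [n] tokens, which puts the pair in the range of
    [slide]. *)
Lemma TS_reach_slack I J :
  is_kpvc adj k I -> is_kpvc adj k J -> I != J -> #|I| = #|J| ->
  k * #|I| <> n \/ #|I| = 1 -> TS_reach adj k I J.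
Proof.
move=> kI kJ neqIJ eqIJ slack; have n0 : 0 < n by lia.
have I0 : 0 < #|I|.
  rewrite card_gt0; apply: contraNneq neqIJ => I0.
  by rewrite I0 eq_sym -cards_eq0 -eqIJ I0 cards0.
have In : #|I| < n.
  rewrite ltn_neqAle -[X in _ <= X]card_ord max_card andbT.
  apply: contraNneq neqIJ => In; have full A : #|A| = n -> A = setT.
    by move=> An; apply/eqP; rewrite eqEcard subsetT cardsT card_ord An leqnn.
  by rewrite (full I) // (full J) // -eqIJ.
have hI := height_cnt I; have hJ := height_cnt J; rewrite -eqIJ in hJ.
have win A : is_kpvc adj k A -> height n #|I| (cnt (tok A)) ->
    forall x, cnt (tok A) x < cnt (tok A) (x + k).
  move=> kA hA; case: (leqP k n) => [le_kn|lt_nk x]; first by apply/cov_cnt/kpvc_cov.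
  exact: height_long (ltnW lt_nk) I0 hA.
have hI' : height n #|I| (fun x => cnt (tok I) x + #|I|).
  case: hI => per st; split=> x; first by rewrite per addnAC.
  by rewrite -addSn !leq_add2r.
(* Both counts gain [#|I|] per turn, and that of [J] is at most [#|I|] within a turn, so raising the
   count of [I] by [#|I|] puts it on top. *)
have le_h x : cnt (tok J) x + 0 <= cnt (tok I) x + #|I|.
  rewrite (height_mod x hI) (height_mod x hJ) addn0 addnAC leq_add2r.
  apply: leq_trans (leq_addl _ _); have := height_mono (x %% n) (n - x %% n) hJ.
  by rewrite subnKC ?cnt_card ?eqIJ; [lia | rewrite ltnW // ltn_mod].
have hJ' : height n #|I| (fun x => cnt (tok J) x + 0).
  by case: hJ => per st; split=> x; rewrite !addn0.
rewrite -(set_of_cnt I #|I|) -(set_of_cnt J 0).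
have valid h' : height n #|I| h' -> (forall x, h' x < h' (x + k)) ->
    is_kpvc adj k (set_of n h').
  move=> hh' hk; case: (leqP k n) => [le_kn|]; last exact: kpvc_big.
  apply/kpvc_cov/cov_cnt => // x; have := hk x.
  by rewrite -[h' x](cnt_tok_set_of _ n0 hh') -[h' (x + k)](cnt_tok_set_of _ n0 hh') ltn_add2l.
have [kn|kn] := eqVneq (k * #|I|) n; last first.
  apply: (@slide n #|I| k) => //; try lia.
    by move=> x; rewrite ltn_add2r; apply: win.
  by move=> x; rewrite !addn0; apply: win.
have {slack} s1 : #|I| = 1 by case: slack.
have {kn} kn : k = n by rewrite -kn s1 muln1.
(* With one token and [k = n] every height gives a cover, and the window [k.+1] avoids the excluded
   equality. *)
apply: (@slide n #|I| k.+1) => //; try lia.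
- move=> h' hh' _; apply: valid => // x; apply: height_long hh' => //.
  by rewrite kn.
- by move=> x; apply: height_long hI'; lia.
- by move=> x; apply: height_long hJ'; lia.
Qed.

(** [n] windows of length [k] laid end to end make [k] turns, and each holds a token. *)
Lemma kpvc_card A : k <= n -> is_kpvc adj k A -> n <= k * #|A|.
Proof.
move=> le_kn /kpvc_cov-/(_ le_kn)/cov_cnt H.
have E m : m <= cnt (tok A) (m * k).
  elim: m => [//|m IH]; apply: leq_ltn_trans IH _.
  by rewrite mulSn addnC H.
by have := E n; rewrite mulnC -[k * n]add0n (height_perM k 0 (height_cnt A)) /cnt big_ord0.
Qed.

(** The count of [kpvc_card] becomes an equality, so every window holds exactly one token; comparing
    the windows at [x] and [x.+1] gives the period [k]. *)
Lemma tight_per A x : k * #|A| = n -> is_kpvc adj k A -> k <= n -> tok A (x + k) = tok A x.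
Proof.
move=> kn kA le_kn; have H := proj1 (cov_cnt _ _) (proj1 (kpvc_cov _ le_kn) kA).
set c := cnt (tok A) in H *.
have E m y : c y + m <= c (y + m * k).
  elim: m => [|m IH]; first by rewrite !addn0.
  by rewrite addnS mulSn [k + _]addnC addnA; apply: leq_ltn_trans IH _.
have {E} E y : c (y + k) = (c y).+1.
  apply/eqP; rewrite eqn_leq H andbT.
  have := height_perM k y (height_cnt A); rewrite -/c kn.
  have := E n.-1 (y + k); rewrite -addnA -mulSn prednK; last lia.
  by rewrite [n * k]mulnC; lia.
have := E x.+1; have := E x; rewrite addSn /c !cntS.
by case: tok; case: tok; lia.
Qed.

(** Both covers have period [k], so with [x] also [x + k] lies in [A :\: B]; the two differ modulo
    [n] because [1 < #|A|] gives [k < n]. *)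
Lemma tight_rigid A B : k * #|A| = n -> 1 < #|A| ->
  is_kpvc adj k A -> is_kpvc adj k B -> TJ_step A B -> False.
Proof.
move=> kn A2 kA kB step; have cAB := TJ_step_card step.
case: step => x [y [Ax _]].
have le_kn : k + k <= n by rewrite -kn addnn -mul2n mulnC leq_mul2l A2 orbT.
have lt_kn : k <= n by lia.
have x_n : (x + k) %% n < n by rewrite ltn_mod; lia.
have : x \in A :\: B by rewrite Ax set11.
rewrite inE => /andP[xB xA].
have : Ordinal x_n \in A :\: B.
  rewrite inE -!(tok_in _ x_n) (tight_per x kn) // (tight_per x _ kB) -?cAB //.
  by rewrite !tok_val xB xA.
rewrite Ax inE -val_eqE /= => /eqP E.
have : x + k == x + 0 %[mod n] by rewrite E addn0 modn_small.
by rewrite eqn_modDl mod0n modn_small; lia.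
Qed.

Definition jump_ok I J : bool := (#|I| == #|J|) && ((k * #|I| != n) || (#|I| == 1)).

Lemma TJ_reach_ok I J : I != J -> TJ_reach adj k I J -> jump_ok I J.
Proof.
move=> neqIJ r; have eqIJ : #|I| = #|J|.
  apply: (reconf_inv (P := fun A => #|I| = #|A|) _ r) => // A B _ _ /TJ_step_card.
  by move=> -> ->.
rewrite /jump_ok eqIJ eqxx -eqIJ /=; case: (eqVneq (k * #|I|) n) => //= kn.
(* With two or more tokens [tight_rigid] forbids a first step, so no sequence joins distinct
   covers. *)
have I2 : #|I| <= 1; last first.
  by rewrite eqn_leq I2; case: #|I| kn => //; rewrite muln0; lia.
rewrite leqNgt; apply/negP => I2; case/eqP: neqIJ; move: {eqIJ} kn I2; move: I r.
apply: reconf_rev_ind => // A B [kA _] step rB _ kn A2.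
by case: (@tight_rigid A B) => //; have [] := reconf_okl rB.
Qed.

Lemma TS_reachP I J : is_kpvc adj k I -> is_kpvc adj k J -> I != J ->
  TS_reach adj k I J <-> jump_ok I J.
Proof.
move=> kI kJ neqIJ; split=> [/TS_TJ_reach|]; first exact: TJ_reach_ok.
case/andP=> /eqP eqIJ slack; apply: TS_reach_slack => //.
by case/orP: slack => /eqP; [left | right].
Qed.

Lemma TJ_reachP I J : is_kpvc adj k I -> is_kpvc adj k J -> I != J ->
  TJ_reach adj k I J <-> jump_ok I J.
Proof.
move=> kI kJ neqIJ; split=> [|ok]; first exact: TJ_reach_ok.
exact/TS_TJ_reach/TS_reachP.
Qed.
End Cycle.

(** * Token addition and removal *)

Section TAR.
Variables (T : finType) (e : rel T) (k u : nat).
Implicit Types A B C : {set T}.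
Local Notation reach := (TAR_reach e k u).

Lemma TAR_step_sym A B : TAR_step A B -> TAR_step B A.
Proof. by rewrite /TAR_step /symdiff setUC. Qed.

Lemma TAR_stepP A B : TAR_step A B ->
  (exists2 x, x \in A & B = A :\ x) \/ (exists2 x, x \notin A & B = x |: A).
Proof.
move/eqP/cards1P => [x /setP E].
have ABx y : (y \in A) (+) (y \in B) = (y == x).
  by rewrite -(in_set1 y x) -E !inE; case: (y \in A); case: (y \in B).
have EB y : (y \in B) = (y \in A) (+) (y == x) by rewrite -ABx addKb.
case: (boolP (x \in A)) => xA; [left | right]; exists x => //; apply/setP=> y;
  by rewrite EB !inE; case: (eqVneq y x) => [->|_]; rewrite ?xA ?(negbTE xA) ?addbF.
Qed.

Lemma TAR_step_rem A x : x \in A -> TAR_step A (A :\ x).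
Proof.
move=> xA; rewrite /TAR_step (_ : symdiff _ _ = [set x]) ?cards1 //.
apply/setP=> y; rewrite !inE; case: (eqVneq y x) => [->|_] /=; first by rewrite xA.
by rewrite andNb.
Qed.

Lemma TAR_reach_sym A B : reach A B -> reach B A.
Proof. by apply: reconf_sym; apply: TAR_step_sym. Qed.

Lemma TAR_reach_sub A C : C \subset A -> is_kpvc e k C -> #|A| <= u -> reach A C.
Proof.
move=> sCA kC; have [m] := ubnP #|A :\: C|; elim: m A sCA => // m IH A sCA lt_m Au.
case: (set_0Vmem (A :\: C)) => [/eqP|[x xAC]].
  rewrite setD_eq0 => sAC; have -> : A = C by apply/eqP; rewrite eqEsubset sAC.
  by apply: reconf_refl; split=> //; apply: leq_trans Au; apply: subset_leq_card.
have [xC xA] : x \notin C /\ x \in A by apply/andP; rewrite -in_setD.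
have le_rem := subset_leq_card (subD1set A x).
apply: reconf_cons (TAR_step_rem xA) _; first by split=> //; apply: kpvc_sub sCA kC.
apply: IH; [by rewrite subsetD1 sCA | | exact: leq_trans Au].
by move: lt_m; rewrite (cardsD1 x) xAC setDDl setUC -setDDl ltnS.
Qed.

(** A jump from [A] to [C] becomes an addition and a removal through [A :|: C], whose size [#|A|.+1]
    is within [u]. *)
Lemma TAR_reach_TJ A B : #|A| < u -> TJ_reach e k A B -> reach A B.
Proof.
move=> Au r; move: (Au); move: A r {Au}; apply: reconf_rev_ind => [[kB _] /ltnW Bu|].
  exact: reconf_refl.
move=> A C [kA _] step rC IH Au; have [kC _] := reconf_okl rC.
have cAC := TJ_step_card step; apply: reconf_trans (IH _); last by rewrite -cAC.
have {rC IH} uAC : #|A :|: C| <= u.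
  case: step => x [y [_ CAy]]; rewrite -(cardsID A) setIUl setIid setDUl setDv set0U CAy cards1.
  by rewrite (setUidPl _) ?subsetIr // addn1.
apply: (@reconf_trans _ _ _ _ _ _ (A :|: C)).
  by apply/TAR_reach_sym/TAR_reach_sub => //; apply: subsetUl.
by apply: TAR_reach_sub => //; apply: subsetUr.
Qed.

Lemma exists_superset A m : #|A| <= m -> m <= #|T| ->
  exists2 B : {set T}, A \subset B & #|B| = m.
Proof.
move=> le_Am; have [d] := ubnP (m - #|A|); elim: d A le_Am => // d IH A le_Am lt_d le_mT.
case: (ltnP #|A| m) => [lt_Am|le_mA]; last first.
  by exists A => //; apply/eqP; rewrite eqn_leq le_Am.
have : A != setT by apply: contraTneq (leq_trans lt_Am le_mT) => ->; rewrite cardsT ltnn.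
rewrite -subTset => /subsetPn[x _ xA].
have cx : #|x |: A| = #|A|.+1 by rewrite cardsU1 xA.
have [|||B sB cB] := IH (x |: A) => //; rewrite ?cx //; first by lia.
by exists B => //; apply: subset_trans sB; apply: subsetUr.
Qed.

Definition nonmin A : Prop := exists2 x, x \in A & is_kpvc e k (A :\ x).

(** At size [u] no token can be added, so the first step has to be a removal. *)
Lemma reach_nonmin A B : A != B -> reach A B -> #|A| < u \/ nonmin A.
Proof.
move=> neqAB r; have [_ /= Au] := reconf_okl r.
rewrite leq_eqVlt in Au; case/predU1P: Au => [Au|]; [right | by left].
move: A r neqAB Au; apply: reconf_rev_ind => [_|A A' okA step r _ _ Au]; first by rewrite eqxx.
have [kA' /= A'u] := reconf_okl r.
case: (TAR_stepP step) => [[x xA EA']|[x xA EA']]; first by exists x; rewrite -?EA'.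
by move: A'u; rewrite EA' cardsU1 xA Au ltnn.
Qed.
End TAR.

(** * The reachability criterion for token addition and removal on cycles *)

Section CycleTAR.
Variables (n k u : nat).
Hypotheses (n3 : 2 < n) (k2 : 1 < k) (u0 : 0 < u).
Implicit Types A B C D I J : {set 'I_n}.
Local Notation adj := (@cycle_adj n).
Local Notation reach := (TAR_reach adj k u).

(** [D] is a minimum cover. Removing one of its tokens is possible only from size [u] and leaves a
    cover of size [#|D|] that differs from [D] by a single jump, against [tight_rigid]. *)
Lemma tight_core D I J : k * #|D| = n -> 1 < #|D| -> u = #|D|.+1 ->
  is_kpvc adj k D -> D \subset I -> reach I J -> D \subset J.
Proof.
move=> kn D2 uD kD sDI r; apply: (reconf_inv (P := fun A => D \subset A) _ r sDI) => {r sDI}.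
move=> A B [kA /= Au] [kB _] step sDA.
have le_kn : k <= n by rewrite -kn leq_pmulr; lia.
have min C : is_kpvc adj k C -> #|D| <= #|C|.
  move=> kC; have : k * #|D| <= k * #|C| by rewrite kn kpvc_card.
  by rewrite leq_mul2l; case/orP => // /eqP; lia.
case: (TAR_stepP step) => [[x xA EB]|[x xA ->]]; last first.
  by apply: subset_trans sDA _; apply: subsetUr.
rewrite EB subsetD1 sDA /=; apply/negP => xD.
have cA := cardsD1 x A; rewrite xA -EB in cA.
have cB : #|B| = #|D| by apply/eqP; rewrite eqn_leq min // andbT -ltnS -uD; move: Au; rewrite cA.
case: (tight_rigid n3 k2 kn D2 kD kB).
have : #|A :\: D| == 1 by rewrite cardsD (setIidPr sDA) cA cB addnK.
case/cards1P => y ADy; exists x, y; split; apply/setP=> z.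
  rewrite EB !inE; case: (eqVneq z x) => [->|_] /=; first by rewrite xD.
  by case: (boolP (z \in D)) => [/(subsetP sDA)->|]; rewrite ?andbF.
rewrite -ADy EB !inE; case: (eqVneq z x) => [->|_] //=.
by rewrite xD.
Qed.

Lemma TAR_reachP I J : is_kpvc adj k I -> is_kpvc adj k J -> I != J ->
  reach I J <->
  [/\ #|I| <= u, #|J| <= u &
    [\/ n < k, cov k (tok (I :&: J)) |
        [/\ #|I| < u \/ nonmin adj k I, #|J| < u \/ nonmin adj k J &
            ~ (k * u.-1 = n /\ 2 < u)]]].
Proof.
move=> kI kJ neqIJ; split=> [r|[Iu Ju]].
  have [_ /= Iu] := reconf_okl r; have [_ /= Ju] := reconf_okr r; split=> //.
  case: (ltnP n k) => [lt_nk|le_kn]; first by apply: Or31.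
  have nI := reach_nonmin neqIJ r.
  have nJ : #|J| < u \/ nonmin adj k J.
    by apply: reach_nonmin (TAR_reach_sym r); rewrite eq_sym.
  case: (boolP ((k * u.-1 == n) && (2 < u))); last first.
    by move=> H; apply: Or33; split=> // -[/eqP E lt_u]; rewrite E lt_u in H.
  case/andP=> /eqP kn lt_u; apply: Or32.
  have min C : is_kpvc adj k C -> u.-1 <= #|C|.
    move=> kC; have : k * u.-1 <= k * #|C| by rewrite kn kpvc_card.
    by rewrite leq_mul2l; case/orP => // /eqP; lia.
  (* [I], after the loss of a removable token if it has size [u], is a minimum cover, and
     [tight_core] carries it into [J]. *)
  have [D [sDI kD cD]] : exists D, [/\ D \subset I, is_kpvc adj k D & #|D| = u.-1].
    case: nI => [lt_Iu|[x xI kx]].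
      by exists I; split=> //; apply/eqP; rewrite eqn_leq min // andbT -ltnS prednK.
    exists (I :\ x); split=> //; first exact: subD1set.
    apply/eqP; rewrite eqn_leq min // andbT -ltnS prednK //.
    by move: Iu; rewrite (cardsD1 x I) xI.
  have sDJ : D \subset J.
    by apply: tight_core kD sDI r; rewrite ?cD //; lia.
  apply/kpvc_cov => //; apply: kpvc_sub kD.
  by rewrite subsetI sDI.
have via C : C \subset I -> C \subset J -> is_kpvc adj k C -> reach I J.
  move=> sCI sCJ kC; apply: (@reconf_trans _ _ _ _ _ _ C); first exact: TAR_reach_sub.
  by apply/TAR_reach_sym/TAR_reach_sub.
case=> [lt_nk|cIJ|[nI nJ slack]].
- by apply: (via set0); rewrite ?sub0set //; apply: kpvc_big.
- case: (ltnP n k) => [lt_nk|le_kn].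
    by apply: (via set0); rewrite ?sub0set //; apply: kpvc_big.
  by apply: (via (I :&: J)); rewrite ?subsetIl ?subsetIr //; apply/kpvc_cov.
have down A : is_kpvc adj k A -> #|A| <= u -> #|A| < u \/ nonmin adj k A ->
    exists C, [/\ #|C| < u, is_kpvc adj k C & reach A C].
  move=> kA Au [lt_Au|[x xA kx]].
    by exists A; split=> //; apply: reconf_refl.
  exists (A :\ x); split=> //; first by apply: leq_trans Au; rewrite [X in _ < X](cardsD1 x) xA.
  by apply: TAR_reach_sub => //; apply: subD1set.
have {nI} [A [Au kA rA]] := down I kI Iu nI.
have {nJ} [B [Bu kB rB]] := down J kJ Ju nJ.
apply: reconf_trans rA _; apply: reconf_trans (TAR_reach_sym rB).
have up C C' : C \subset C' -> is_kpvc adj k C -> #|C'| <= u -> reach C C'.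
  by move=> sCC' kC C'u; apply/TAR_reach_sym/TAR_reach_sub.
case: (leqP n u) => [le_nu|lt_un].
  have Tu : #|[set: 'I_n]| <= u by rewrite cardsT card_ord.
  apply: (@reconf_trans _ _ _ _ _ _ setT); first by apply: up; rewrite ?subsetT.
  by apply: TAR_reach_sub; rewrite ?subsetT.
(* Padding to size [u.-1] gives equal sizes and leaves room for one token, as [TAR_reach_TJ]
   requires. *)
have [||A' sAA' cA'] := @exists_superset _ A u.-1; rewrite ?card_ord; try lia.
have [||B' sBB' cB'] := @exists_superset _ B u.-1; rewrite ?card_ord; try lia.
have kA' := kpvc_sub sAA' kA; have kB' := kpvc_sub sBB' kB.
apply: (@reconf_trans _ _ _ _ _ _ A'); first by apply: up; rewrite ?cA' ?leq_pred.
apply: (@reconf_trans _ _ _ _ _ _ B'); last by apply: TAR_reach_sub; rewrite ?cB' ?leq_pred.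
case: (eqVneq A' B') => [<-|neq]; first by apply: reconf_refl; rewrite cA' leq_pred.
apply: TAR_reach_TJ; first by rewrite cA' prednK.
apply/TS_TJ_reach/TS_reach_slack => //; first by rewrite cA'.
(* If [k * u.-1 = n], then [slack] leaves [u <= 2], hence [u.-1 = 1]. *)
rewrite cA'; case: (eqVneq (k * u.-1) n) => [kn|/eqP]; [right | by left].
by case: (ltnP 2 u) => [lt_u|le_u]; [case: slack | lia].
Qed.
End CycleTAR.

(** * Scanning the cyclic word *)

Definition has_three (k : nat) (b : nat -> bool) (i : nat) : Prop :=
  exists j1 j2 j3, [/\ j1 < j2 < j3, j3 < i, j3 <= j1 + k & [&& b j1, b j2 & b j3]].

Definition has_gap (k : nat) (b : nat -> bool) (i : nat) : Prop :=
  exists2 x, x + k <= i & forall j, j < k -> ~~ b (x + j).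

(* Up to values above [k], [d1] and [d2] are the distances from [i] back to the
   last and to the last but one token. *)
Definition gap_inv (k : nat) (b : nat -> bool) (i d1 d2 f : nat) : Prop :=
  [/\ forall t, t <= k -> (d1 <= t) <-> exists j, [/\ j < i, i <= j + t & b j],
      forall t, t <= k -> (d2 <= t) <->
        exists j1 j2, [/\ j1 < j2 < i, i <= j1 + t & b j1 && b j2],
      f <= 1 & f = 1 <-> has_three k b i].

(** [c] is the length of the token-free run that ends just before [i], and [g] records whether some
    run has reached length [k]. *)
Definition run_inv (k : nat) (b : nat -> bool) (i c g : nat) : Prop :=
  [/\ c <= i, forall j, j < i -> i <= j + c -> ~~ b j,
      c < i -> b (i - c.+1), g <= 1 & g = 1 <-> has_gap k b i].

(** The start value [k.+1] stands for infinity, as only thresholds [t <= k] are looked at. *)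
Lemma gap_inv0 k b : gap_inv k b 0 k.+1 k.+1 0.
Proof.
split=> // [t le_t|t le_t|]; split=> //; try lia.
- by case=> j [].
- by case=> j1 [j2 [/andP[]]].
- by case=> j1 [j2 [j3 []]].
Qed.

(** The new token completes a triple exactly when the last but one token lies at distance at most
    [k]; [d2 - k == 0] is how the machine tests this. *)
Lemma gap_inv_hit k b i d1 d2 f : gap_inv k b i d1 d2 f -> b i ->
  gap_inv k b i.+1 1 (d1 + 1) (if d2 - k == 0 then 1 else f).
Proof.
move=> [H1 H2 f1 H3] bi; split.
- move=> t le_t; split=> [t1|[j [lt_j le_i bj]]]; last lia.
  by exists i; split=> //; lia.
- move=> t le_t; split=> [le_d|[j1 [j2 [lt_j le_i /andP[b1 b2]]]]].
    have [t1 d1t] : t.-1 <= k /\ d1 <= t.-1 by lia.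
    have [j [lt_j le_i bj]] := proj1 (H1 _ t1) d1t.
    by exists j, i; split; [lia | lia | rewrite bj].
  have : d1 <= t.-1; last by lia.
  by apply: (proj2 (H1 t.-1 _)); [lia | exists j1; split=> //; lia].
- by case: ifP.
case: eqP => d2k; split=> //.
- move=> _; have d2k' : d2 <= k by lia.
  have [j1 [j2 [lt_j le_i /andP[b1 b2]]]] := proj1 (H2 k (leqnn _)) d2k'.
  by exists j1, j2, i; split=> //; rewrite b1 b2.
- case/H3 => j1 [j2 [j3 [lt_j lt_i le_k b3]]].
  by exists j1, j2, j3; split=> //; lia.
- case=> j1 [j2 [j3 [lt_j]]]; rewrite ltnS leq_eqVlt => /predU1P[E|lt_i le_k b3].
    subst j3 => le_i /and3P[b1 b2 _]; case: d2k; apply/eqP; rewrite subn_eq0.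
    by apply/H2 => //; exists j1, j2; split=> //; rewrite b1.
  by apply/H3; exists j1, j2, j3.
Qed.

Lemma gap_inv_miss k b i d1 d2 f : gap_inv k b i d1 d2 f -> ~~ b i ->
  gap_inv k b i.+1 (d1 + 1) (d2 + 1) f.
Proof.
move=> [H1 H2 f1 H3] nbi.
have old j : j < i.+1 -> b j -> j < i.
  by rewrite ltnS leq_eqVlt => /predU1P[->|//]; rewrite (negbTE nbi).
split=> //.
- move=> t le_t; split=> [le_d|[j [lt_j le_i bj]]].
    have [t1 d1t] : t.-1 <= k /\ d1 <= t.-1 by lia.
    have [j [lt_j le_i bj]] := proj1 (H1 _ t1) d1t.
    by exists j; split=> //; lia.
  have lt_ji := old j lt_j bj.
  have : d1 <= t.-1; last by lia.
  by apply: (proj2 (H1 t.-1 _)); [lia | exists j; split=> //; lia].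
- move=> t le_t; split=> [le_d|[j1 [j2 [/andP[lt_j lt_i] le_i /andP[b1 b2]]]]].
    have [t1 d2t] : t.-1 <= k /\ d2 <= t.-1 by lia.
    have [j1 [j2 [lt_j le_i bj]]] := proj1 (H2 _ t1) d2t.
    by exists j1, j2; split=> //; lia.
  have lt_ji := old j2 lt_i b2.
  have : d2 <= t.-1; last by lia.
  by apply: (proj2 (H2 t.-1 _)); [lia | exists j1, j2; split; [lia | lia | rewrite b1]].
rewrite H3; split=> -[j1 [j2 [j3 [lt_j lt_i le_k b3]]]]; exists j1, j2, j3; split=> //.
  exact: ltnW.
by apply: old => //; case/and3P: b3.
Qed.

Lemma run_inv0 k b : 0 < k -> run_inv k b 0 0 0.
Proof. by move=> k0; split=> //; split=> // -[x]; lia. Qed.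

Lemma run_inv_hit k b i c g : 0 < k -> run_inv k b i c g -> b i -> run_inv k b i.+1 0 g.
Proof.
move=> k0 [H1 H2 H3 H4 H5] bi; split=> //; first by move=> j; lia.
  by rewrite subSS subn0.
rewrite H5; split=> -[x le_x H]; exists x => //; first exact: leqW.
rewrite leqNgt; apply/negP => lt_i.
have /H : i - x < k by lia.
by rewrite subnKC ?bi //; lia.
Qed.

Lemma run_inv_miss k b i c g : run_inv k b i c g -> ~~ b i ->
  run_inv k b i.+1 (c + 1) (if k - (c + 1) == 0 then 1 else g).
Proof.
move=> [H1 H2 H3 H4 H5] nbi.
have zero j : j < i.+1 -> i.+1 <= j + (c + 1) -> ~~ b j.
  rewrite ltnS leq_eqVlt => /predU1P[-> //|lt_j le_i].
  by apply: H2 => //; lia.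
split=> //; first by lia.
- by rewrite addn1 subSS => lt_c; apply: H3.
- by case: ifP.
case: eqP => le_k; split=> //.
- by exists (i.+1 - k) => [|j lt_j]; [lia | apply: zero; lia].
- by case/H5 => x le_x H; exists x => //; apply: leqW.
case=> x le_x H; apply/H5; exists x => //; rewrite leqNgt; apply/negP => lt_i.
(* A window ending at [i] and longer than the current run would contain the token just before the
   run. *)
have := H (i - c.+1 - x); rewrite subnKC; last by lia.
by move=> H6; move: (H3); case/(_ _)/negP: H6; lia.
Qed.

(** * What two turns of the periodic word tell about a cover *)

Section Periodic.
Variables (n k : nat).
Hypotheses (n3 : 2 < n) (k2 : 1 < k) (le_kn : k <= n).
Implicit Type X : {set 'I_n}.
Local Notation adj := (@cycle_adj n).

(** Two turns suffice: a window that starts in the first turn ends within the second because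
    [k <= n]. *)
Lemma cov_or_gap X : cov k (tok X) \/ has_gap k (tok X) (n + n).
Proof.
have [/existsP[x /forallP H]|] :=
    boolP [exists x : 'I_n, [forall j : 'I_k, ~~ tok X (x + j)]].
  right; exists x => [|j lt_j]; first by have := ltn_ord x; lia.
  exact: (H (Ordinal lt_j)).
rewrite negb_exists => /forallP H; left=> x.
have x_n : x %% n < n by rewrite ltn_mod; lia.
have := H (Ordinal x_n); rewrite negb_forall => /existsP[j]; rewrite negbK /= => tj.
by exists j => //; rewrite -tok_mod -modnDml tok_mod.
Qed.

Lemma has_gapP X : has_gap k (tok X) (n + n) <-> ~ cov k (tok X).
Proof.
split=> [[x _ H] /(_ x)[j /H/negP]//|ncov].
by case: (cov_or_gap X).
Qed.

Lemma tok_rem X (x : 'I_n) y : tok (X :\ x) y = (y != x %[mod n]) && tok X y.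
Proof.
have y_n : y %% n < n by rewrite ltn_mod; lia.
by rewrite !(tok_in _ y_n) !inE -val_eqE /= [x %% n]modn_small.
Qed.

Lemma neq_mod x y : x < y -> y < x + n -> (y == x %[mod n]) = false.
Proof.
move=> lt_xy lt_yx; apply/negP => E.
have : x + (y - x) == x + 0 %[mod n] by rewrite addn0 subnKC // ltnW.
by rewrite eqn_modDl mod0n modn_small; lia.
Qed.

Lemma last_before (b : pred nat) x y : b x -> x < y ->
  exists z, [/\ z < y, b z & forall w, z < w < y -> ~~ b w].
Proof.
move=> bx; elim: y => // y IH; rewrite ltnS => le_xy.
case: (boolP (b y)) => [by_|nby]; first by exists y; split=> // w; lia.
move: le_xy; rewrite leq_eqVlt => /predU1P[E|/IH[z [lt_z bz H]]].
  by rewrite -E bx in nby.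
exists z; split=> //; first exact: ltnW.
move=> w /andP[lt_w]; rewrite ltnS leq_eqVlt => /predU1P[-> //|lt_wy].
by apply: H; rewrite lt_w.
Qed.

(** A window of length [k] around the middle token of such a triple also contains an outer one.
    Conversely, the neighbours of a removable token are at distance at most [k], or a window between
    them would be left uncovered. *)
Lemma has_threeP X : is_kpvc adj k X ->
  has_three k (tok X) (n + n) <-> nonmin adj k X.
Proof.
have n0 : 0 < n by lia.
move=> /(kpvc_cov n3 k2 _ le_kn) cX; split.
  move=> [j1 [j2 [j3 [/andP[lt12 lt23] lt3n le_3 /and3P[b1 b2 b3]]]]].
  have x_n : j2 %% n < n by rewrite ltn_mod.
  exists (Ordinal x_n); first by rewrite -tok_in.
  apply/kpvc_cov => // w.
  (* The shift by two turns places the token found in the window beyond [j2], so that differences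
     can be taken in the naturals. *)
  have [j lt_j tj] := cX (w + 2 * n).
  have [E|neq] := eqVneq ((w + 2 * n + j) %% n) (j2 %% n); last first.
    by exists j => //; rewrite -(tok_perM _ _ 2) addnAC tok_rem /= modn_mod neq.
  set p := w + 2 * n + j in E tj.
  have [m Ep] : exists m, p = j2 + m * n.
    have le_p : j2 <= p by lia.
    have dv : n %| p - j2 by rewrite -eqn_mod_dvd // E.
    by exists ((p - j2) %/ n); rewrite divnK // subnKC.
  have rem y : tok X y -> y != p %[mod n] -> tok (X :\ Ordinal x_n) y.
    by rewrite tok_rem /= modn_mod -E => -> ->.
  (* A window that starts after the left token of the triple reaches the right one. *)
  case: (leqP (w + 2 * n) (j1 + m * n)) => le_w.
    exists (j1 + m * n - (w + 2 * n)); first by lia.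
    rewrite -(tok_perM _ _ 2) addnAC subnKC //.
    by apply: rem; [rewrite tok_perM | rewrite eq_sym neq_mod //; lia].
  exists (j3 + m * n - (w + 2 * n)); first by lia.
  rewrite -(tok_perM _ _ 2) addnAC subnKC; last lia.
  by apply: rem; [rewrite tok_perM | rewrite neq_mod //; lia].
case=> x xX /(kpvc_cov n3 k2 _ le_kn) cY.
have subY y : tok (X :\ x) y -> tok X y by rewrite tok_rem => /andP[].
(* The copy [x + n] of the token has another token to its left, already among the first [k]
   positions. *)
have np : tok (X :\ x) (x + n) = false by rewrite tok_per tok_rem eqxx.
have [j lt_j tj] := cY 0.
have [|z [lt_z tz last_z]] := last_before (y := x + n) tj; first lia.
have [i lt_i ti] := cY z.+1.
have lt_p : x + n < z.+1 + i.
  have neq : z.+1 + i != x + n by apply: contraTneq ti => ->; rewrite np.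
  have : ~ (z < z.+1 + i < x + n) by move/last_z; rewrite ti.
  by lia.
(* Subtracting whole turns brings the left token below [n], hence the right one below [n + n]. *)
have le_mz : z %/ n * n <= z by apply: leq_trunc_div.
have lt_r : z - z %/ n * n < n by rewrite {1}(divn_eq z n) addKn ltn_mod.
set m := z %/ n * n in le_mz lt_r.
have shift y : m <= y -> tok X (y - m) = tok X y.
  by move=> le_my; rewrite -[in RHS](subnK le_my) tok_perM.
exists (z - m), (x + n - m), (z.+1 + i - m); split; try lia.
by rewrite !shift ?(subY _ tz) ?(subY _ ti) ?tok_per ?tok_val ?xX //; lia.
Qed.
End Periodic.

(** * Structured programs for the RAM *)

Definition mem := nat -> nat.

Inductive cmd : Type :=
| Skip
| Ins of instr
| Seq of cmd & cmd
| Ifz of nat & cmd & cmd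
| While of nat & cmd.

Fixpoint len (c : cmd) : nat :=
  match c with
  | Skip => 0
  | Ins _ => 1
  | Seq c1 c2 => len c1 + len c2
  | Ifz _ c1 c2 => (len c2 + len c1).+2
  | While _ c1 => (len c1).+2
  end.

(** Jump targets are absolute, hence the offset [o]. In a conditional the nonzero branch comes
    first, followed by a jump over the zero branch. *)
Fixpoint code (o : nat) (c : cmd) : seq instr :=
  match c with
  | Skip => [::]
  | Ins i => [:: i]
  | Seq c1 c2 => code o c1 ++ code (o + len c1) c2
  | Ifz r c1 c2 =>
      Jz r (o + (len c2).+2) ::
      code o.+1 c2 ++ Jmp (o + (len c2 + len c1).+2) :: code (o + (len c2).+2) c1
  | While r c1 => Jz r (o + (len c1).+2) :: code o.+1 c1 ++ [:: Jmp o]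
  end.

Lemma size_code c o : size (code o c) = len c.
Proof.
elim: c o => [|i|c1 IH1 c2 IH2|r c1 IH1 c2 IH2|r c1 IH1] o //=.
- by rewrite size_cat IH1 IH2.
- by rewrite size_cat /= IH1 IH2 addnS.
- by rewrite size_cat /= IH1 addn1.
Qed.

Definition loaded (P : program) (o : nat) (l : seq instr) : Prop :=
  forall i, i < size l -> nth Halt P (o + i) = nth Halt l i.

Lemma loaded_cat P o l1 l2 :
  loaded P o (l1 ++ l2) -> loaded P o l1 /\ loaded P (o + size l1) l2.
Proof.
move=> H; split=> i Hi.
- by rewrite H ?size_cat ?nth_cat ?Hi //; lia.
- by rewrite -addnA H ?size_cat ?nth_cat ?ltn_add2l // ifF ?addKn //; lia.
Qed.

Lemma loaded_cons P o i l :
  loaded P o (i :: l) -> nth Halt P o = i /\ loaded P o.+1 l.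
Proof.
move=> H; split=> [|j Hj]; first by have := H 0 isT; rewrite addn0.
by rewrite addSnnS (H j.+1).
Qed.

Local Arguments exec : simpl never.

(** Quantifying over every host program and offset makes the statement compose. *)
Definition runs (c : cmd) (M : mem) (t : nat) (M' : mem) : Prop :=
  forall P o, loaded P o (code o c) -> exec P t (o, M) = (o + len c, M').

Lemma execD P s t x : exec P (s + t) x = exec P t (exec P s x).
Proof. by rewrite /exec addnC iterD. Qed.

Lemma execS P t x : exec P t.+1 x = exec P t (step P x).
Proof. by rewrite /exec iterSr. Qed.

Definition basic (i : instr) : bool :=
  match i with Jz _ _ | Jmp _ | Halt => false | _ => true end.

Definition effect (i : instr) (M : mem) : mem :=
  match i with
  | Const d v => upd M d v
  | Add d a b => upd M d (M a + M b)
  | Defs.Sub d a b => upd M d (M a - M b)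
  | LoadI d a => upd M d (M (M a))
  | StoreI a s => upd M (M a) (M s)
  | _ => M
  end.

Lemma runs_skip M : runs Skip M 0 M.
Proof. by move=> P o _; rewrite addn0. Qed.

Lemma runs_ins i M : basic i -> runs (Ins i) M 1 (effect i M).
Proof.
move=> Hi P o /loaded_cons[E _].
by rewrite execS /step E addn1; case: i Hi {E}.
Qed.

Lemma runs_seq c1 c2 M t1 M1 t2 M2 :
  runs c1 M t1 M1 -> runs c2 M1 t2 M2 -> runs (Seq c1 c2) M (t1 + t2) M2.
Proof.
move=> H1 H2 P o /loaded_cat[L1]; rewrite size_code => L2.
by rewrite execD H1 // H2 //= addnA.
Qed.

Lemma runs_ifz_true r c1 c2 M t M' :
  M r = 0 -> runs c1 M t M' -> runs (Ifz r c1 c2) M t.+1 M'.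
Proof.
move=> r0 H P o /= /loaded_cons[E /loaded_cat[_]].
rewrite size_code => /loaded_cons[_ L].
have Eo : (o.+1 + len c2).+1 = o + (len c2).+2 by lia.
rewrite execS /step E r0 /= H; first by congr (_, _); lia.
by rewrite -Eo in L *.
Qed.

Lemma runs_ifz_false r c1 c2 M t M' :
  M r != 0 -> runs c2 M t M' -> runs (Ifz r c1 c2) M t.+2 M'.
Proof.
move=> /negbTE r0 H P o /= /loaded_cons[E /loaded_cat[L]].
rewrite size_code => /loaded_cons[E' _].
rewrite execS /step E r0 -/(step P) -addn1 execD H //.
by rewrite execS /step E' /=.
Qed.

Lemma runs_while_end r c M : M r = 0 -> runs (While r c) M 1 M.
Proof. by move=> r0 P o /= /loaded_cons[E _]; rewrite execS /step E r0. Qed.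

Lemma runs_while_next r c M t M1 t' M' :
  M r != 0 -> runs c M t M1 -> runs (While r c) M1 t' M' ->
  runs (While r c) M (t + t').+2 M'.
Proof.
move=> /negbTE r0 H H' P o L; have := L => /= /loaded_cons[E /loaded_cat[L1]].
rewrite size_code => /loaded_cons[E' _].
rewrite execS /step E r0 -/(step P) -addnS execD H // execS /step E'.
exact: H'.
Qed.

Fixpoint loopfree (c : cmd) : bool :=
  match c with
  | Skip => true
  | Ins i => basic i
  | Seq c1 c2 | Ifz _ c1 c2 => loopfree c1 && loopfree c2
  | While _ _ => false
  end.

(* A junk value on loops. *)
Fixpoint den (c : cmd) (M : mem) : mem :=
  match c with
  | Skip => M
  | Ins i => effect i M
  | Seq c1 c2 => den c2 (den c1 M)
  | Ifz r c1 c2 => if M r == 0 then den c1 M else den c2 M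
  | While _ _ => M
  end.

Lemma runs_den c M :
  loopfree c -> exists2 t, t <= (len c).*2 & runs c M t (den c M).
Proof.
elim: c M => [|i|c1 IH1 c2 IH2|r c1 IH1 c2 IH2|//] M /=.
- by exists 0 => //; apply: runs_skip.
- by exists 1 => //; apply: runs_ins.
- case/andP=> lf1 lf2; have [t1 le1 H1] := IH1 M lf1.
  have [t2 le2 H2] := IH2 (den c1 M) lf2.
  by exists (t1 + t2); [lia | apply: runs_seq H1 H2].
- case/andP=> lf1 lf2; have [t1 le1 H1] := IH1 M lf1.
  have [t2 le2 H2] := IH2 M lf2.
  case: eqVneq => [r0|r0].
    by exists t1.+1; [lia | apply: runs_ifz_true].
  by exists t2.+2; [lia | apply: runs_ifz_false].
Qed.

Definition triple (pre : mem -> Prop) (c : cmd) (t : nat) (post : mem -> Prop) : Prop :=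
  forall M, pre M -> exists t' M', [/\ t' <= t, runs c M t' M' & post M'].

Lemma triple_den (pre post : mem -> Prop) c :
  loopfree c -> (forall M, pre M -> post (den c M)) ->
  triple pre c (len c).*2 post.
Proof.
move=> lf H M /H post_M; have [t le_t run] := runs_den M lf.
by exists t, (den c M).
Qed.

Lemma triple_seq pre mid post c1 c2 t1 t2 :
  triple pre c1 t1 mid -> triple mid c2 t2 post ->
  triple pre (Seq c1 c2) (t1 + t2) post.
Proof.
move=> H1 H2 M /H1[t1' [M1 [le1 run1 /H2[t2' [M2 [le2 run2 post2]]]]]].
by exists (t1' + t2'), M2; split=> //; [exact: leq_add | exact: runs_seq run1 run2].
Qed.

(** The loop register counts down from [N]; each round pays two steps for the test and the jump
    back, and the last test one more. *)
Lemma triple_while (inv : nat -> mem -> Prop) r c t N :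
  (forall i M, inv i M -> M r = N - i) ->
  (forall i, i < N -> triple (inv i) c t (inv i.+1)) ->
  triple (inv 0) (While r c) (N * t.+2).+1 (inv N).
Proof.
move=> Hr Hc M0 inv0.
suff H m : forall i M, m + i = N -> inv i M ->
    exists t' M', [/\ t' <= (m * t.+2).+1, runs (While r c) M t' M' & inv N M'].
  by apply: (H N 0) => //; rewrite addn0.
elim: m => [|m IH] i M mi invi.
  exists 1, M; split=> //; last by rewrite -mi.
  by apply: runs_while_end; rewrite (Hr _ _ invi); lia.
have lt_iN : i < N by lia.
have [t1 [M1 [le1 run1 inv1]]] := Hc i lt_iN M invi.
have Ei : m + i.+1 = N by lia.
have [t2 [M2 [le2 run2 inv2]]] := IH i.+1 M1 Ei inv1.
exists (t1 + t2).+2, M2; split=> //; first by rewrite mulSn; lia.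
by apply: runs_while_next run1 run2; rewrite (Hr _ _ invi); lia.
Qed.

Lemma triple_decides c t T pre M0 (b : Prop) :
  triple pre c t (fun M => M 0 <= 1 /\ (M 0 = 1 <-> b)) -> pre M0 -> t <= T ->
  decides_within (code 0 c) T M0 b.
Proof.
move=> H /H[t' [M [le_t' run post]]] le_T.
rewrite /decides_within.
have E : exec (code 0 c) t' (0, M0) = (len c, M) by apply: run => i.
have Hh : nth Halt (code 0 c) (len c) = Halt by rewrite nth_default ?size_code.
(* Past the end of the code the machine stands still, so the time left up to [T] changes nothing. *)
have -> : exec (code 0 c) T (0, M0) = (len c, M).
  rewrite -(subnKC (leq_trans le_t' le_T)) execD E.
  by elim: (T - t') => [//|m IH]; rewrite execS /step Hh.
by rewrite /halted /cur /= Hh.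
Qed.

(** * The decision programs *)

Definition block (s : seq instr) : cmd := foldr (fun i => Seq (Ins i)) Skip s.

(** Saves an input cell whose address is about to serve as a register. *)
Definition stash (a : nat) : cmd := block [:: Add 0 0 3; StoreI 0 a].

(* Registers 0, 3 and 4 hold the target address, the constant 1 and the source
   address; the base address 32 * n lies above both the input and all registers. *)
Definition setup : cmd :=
  Seq (block [:: Add 0 1 1; Add 0 0 0; Add 0 0 0; Add 0 0 0; Add 0 0 0; StoreI 0 3; Const 3 1])
  (Seq (stash 4) (Seq (stash 5) (Seq (stash 6) (Seq (stash 7) (Seq (stash 8)
  (block [:: Add 0 0 3; Const 4 9; Add 5 1 1])))))).

(** Starting at address 9, [n + n] rounds pass the end of the input by six cells, which hold 0. *)
Definition copy_cell : cmd :=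
  block [:: LoadI 6 4; StoreI 0 6; Add 4 4 3; Add 0 0 3; Defs.Sub 5 5 3].

(* Register 0 points to the current cell, 4 counts down to the end of the pass
   and 18 holds k; 8 and 9 count the tokens of I and J (twice in the end, as
   there are two passes), 10-12 and 13-15 hold the data of [gap_inv] for I and J,
   16-17 those of [run_inv] for their intersection. *)
Definition init (k : nat) : cmd :=
  block [:: Add 0 1 1; Add 0 0 0; Add 0 0 0; Add 0 0 0; Add 0 0 0;
    Const 5 0; Add 4 1 5; Const 8 0; Const 9 0;
    Const 10 k.+1; Const 11 k.+1; Const 12 0; Const 13 k.+1; Const 14 k.+1; Const 15 0;
    Const 16 0; Const 17 0; Const 18 k].

Definition read_bits : cmd := block [:: LoadI 5 0; Add 7 0 1; LoadI 6 7].

Definition scan_gap (bit r : nat) : cmd :=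
  Ifz bit (block [:: Add r r 3; Add r.+1 r.+1 3])
    (Seq (Ins (Defs.Sub 7 r.+1 18))
    (Seq (Ifz 7 (Ins (Const r.+2 1)) Skip)
    (block [:: Add r.+1 r 3; Const r 1]))).

(** With truncated subtraction, the sum of two bits minus 1 is their conjunction. *)
Definition scan_run : cmd :=
  Seq (block [:: Add 7 5 6; Defs.Sub 7 7 3])
  (Ifz 7 (Seq (block [:: Add 16 16 3; Defs.Sub 7 18 16]) (Ifz 7 (Ins (Const 17 1)) Skip))
    (Ins (Const 16 0))).

Definition scan_body : cmd :=
  Seq (block [:: Add 8 8 5; Add 9 9 6])
  (Seq (scan_gap 5 10) (Seq (scan_gap 6 13) (Seq scan_run
  (block [:: Add 0 0 3; Defs.Sub 4 4 3])))).

(** The pointer goes back while the data of the scan are kept, so the second pass reads the second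
    turn of the periodic word. *)
Definition rewind : cmd := block [:: Const 5 0; Add 4 1 5; Defs.Sub 0 0 1].

Definition pass : cmd := While 4 (Seq read_bits scan_body).

Definition decide (k : nat) (final : cmd) : cmd :=
  Seq setup (Seq (While 5 copy_cell) (Seq (init k) (Seq pass (Seq rewind (Seq pass final))))).

Lemma upd_ne M a v x : x != a -> upd M a v x = M x.
Proof. by rewrite /upd => /negbTE->. Qed.

Lemma upd_eq M a v : upd M a v a = v.
Proof. by rewrite /upd eqxx. Qed.

(** Forgetting all but [Q] between two commands keeps the symbolic memories small. *)
Lemma den_seqP (Q P : mem -> Prop) c1 c2 M :
  Q (den c1 M) -> (forall M', Q M' -> P (den c2 M')) -> P (den (Seq c1 c2) M).
Proof. by move=> q; apply. Qed.

(** * Correctness and cost of the scanning program *)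

Section Run.
Variables (n u k : nat) (I J : {set 'I_n}).
Hypotheses (n3 : 2 < n) (k0 : 0 < k).
Let inp := encode n u I J.

(** Register 0 points to the last cell written, hence the successor; in [copied] it points to the
    next cell to write. *)
Definition stashed (j : nat) (M : mem) : Prop :=
  [/\ (M 0).+1 = 32 * n + j, M 1 = n, M 2 = u & M 3 = 1] /\
  (forall i, i < j -> M (32 * n + i) = inp (3 + i)) /\
  (forall x, 3 + j <= x -> x < 32 * n -> M x = inp x).

Lemma stash_step j M : 0 < j -> 3 + j < 32 * n -> stashed j M ->
  stashed j.+1 (den (stash (3 + j)) M).
Proof.
move=> j0 lt_j [[E0 E1 E2 E3] [H1 H2]]; rewrite /stash /=.
have EA : M 0 + M 3 = 32 * n + j by rewrite E3; lia.
rewrite /stashed /upd /= EA.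
split; first by split; case: eqP => //; lia.
split=> [i lt_i|x le_x lt_x].
  case: eqP => [E|ne]; first by rewrite H2 //; congr inp; lia.
  by rewrite ifF ?H1 //; lia.
by rewrite !ifF ?H2 //; lia.
Qed.

Definition copied (i : nat) (M : mem) : Prop :=
  [/\ M 0 = 32 * n + 6 + i, M 1 = n & M 2 = u] /\
  [/\ M 3 = 1, M 4 = 9 + i & M 5 = n + n - i] /\
  (forall j, j < 6 + i -> M (32 * n + j) = inp (3 + j)) /\
  (forall x, 9 <= x -> x < 32 * n -> M x = inp x).

Lemma base32 : n + n + (n + n) + (n + n + (n + n)) +
    (n + n + (n + n) + (n + n + (n + n))) +
    (n + n + (n + n) + (n + n + (n + n)) +
     (n + n + (n + n) + (n + n + (n + n)))) = 32 * n.
Proof. lia. Qed.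

Lemma setup_spec M : M =1 inp -> copied 0 (den setup M).
Proof.
move=> EM; rewrite /setup; apply: (den_seqP (Q := stashed 1)) => [|{EM}M S1].
  rewrite /= /stashed /upd /= !EM -[inp 1]/n -[inp 2]/u base32.
  split; first by split; rewrite ?ifF //; lia.
  split=> [[|//] _|x le_x lt_x]; first by rewrite ifF ?ifT //; lia.
  by rewrite !ifF ?EM //; lia.
apply: (den_seqP (Q := stashed 2)) => [|{S1}M S2]; first by apply: (stash_step (j := 1)) => //; lia.
apply: (den_seqP (Q := stashed 3)) => [|{S2}M S3]; first by apply: (stash_step (j := 2)) => //; lia.
apply: (den_seqP (Q := stashed 4)) => [|{S3}M S4]; first by apply: (stash_step (j := 3)) => //; lia.
apply: (den_seqP (Q := stashed 5)) => [|{S4}M S5]; first by apply: (stash_step (j := 4)) => //; lia.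
apply: (den_seqP (Q := stashed 6)) => [|{S5}M S6]; first by apply: (stash_step (j := 5)) => //; lia.
case: S6 => [[E0 E1 E2 E3] [H1 H2]].
rewrite /= /copied /upd /= !E1 E3; split; [|split; [|split]]; try by split; lia.
  by move=> j lt_j; rewrite !ifF ?H1 //; lia.
by move=> x le_x lt_x; rewrite !ifF ?H2 //; lia.
Qed.

Lemma copy_spec i M : i < n + n -> copied i M -> copied i.+1 (den copy_cell M).
Proof.
move=> lt_i [[E0 E1 E2] [[E3 E4 E5] [H1 H2]]].
have Ev : M (9 + i) = inp (3 + (6 + i)) by rewrite H2 //; lia.
rewrite /copy_cell /= /copied /upd /= !(E0, E1, E2, E3, E4, E5) Ev.
have ne r : r < 96 -> (r == 32 * n + 6 + i) = false by lia.
rewrite !ne //; split; [|split; [|split]]; try by split; lia.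
- move=> j lt_j; have ne' r : r < 96 -> (32 * n + j == r) = false by lia.
  rewrite (ne' 5) // (ne' 0) // (ne' 4) // (ne' 6) //.
  case: eqP => [E|ne'']; first by congr inp; lia.
  by apply: H1; lia.
- by move=> x le_x lt_x; rewrite !ifF ?H2 //; lia.
Qed.

(** [q] counts the positions read in earlier passes and [p] those of the current one. *)
Definition scanning (q p : nat) (M : mem) : Prop :=
  [/\ M 0 = 32 * n + p, M 1 = n & M 2 = u] /\
  [/\ M 3 = 1, M 4 = n - p & M 18 = k] /\
  [/\ M 8 = cnt (tok I) (q + p) & M 9 = cnt (tok J) (q + p)] /\
  [/\ gap_inv k (tok I) (q + p) (M 10) (M 11) (M 12),
      gap_inv k (tok J) (q + p) (M 13) (M 14) (M 15) &
      run_inv k (tok (I :&: J)) (q + p) (M 16) (M 17)] /\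
  (forall j, j < n -> M (32 * n + j) = tok I j /\ M (32 * n + j + n) = tok J j).

Lemma inpI j : j < n -> inp (3 + j) = tok I j.
Proof.
move=> lt_j; rewrite /inp /encode /= ltn_add2l lt_j /tok modn_small //.
by congr (nat_of_bool (in_set_nat _ _)); lia.
Qed.

Lemma inpJ j : j < n -> inp (3 + (j + n)) = tok J j.
Proof.
move=> lt_j; rewrite /inp /encode /= ifF; last by lia.
rewrite ifT; last by lia.
by rewrite /tok modn_small //; congr (nat_of_bool (in_set_nat _ _)); lia.
Qed.

Lemma init_spec M : copied (n + n) M -> scanning 0 0 (den (init k) M).
Proof.
move=> [[E0 E1 E2] [[E3 E4 E5] [H1 H2]]].
rewrite /init /= /scanning /upd /= !E1 base32 /cnt !big_ord0.
split; [|split; [|split; [|split]]]; rewrite ?addn0 ?subn0 //.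
  by split; [exact: gap_inv0 | exact: gap_inv0 | exact: run_inv0].
move=> j lt_j; rewrite !ifF; try lia.
split; first by rewrite H1 ?inpI //; lia.
by rewrite -addnA H1 ?inpJ //; lia.
Qed.

Lemma rewind_spec M : scanning 0 n M -> scanning n 0 (den rewind M).
Proof.
move=> [[E0 E1 E2] [[E3 E4 E18] [[E8 E9] [[HI HJ HR] H]]]].
rewrite add0n in E8 E9 HI HJ HR.
rewrite /rewind /= /scanning /upd /= !addn0 E0 E1.
split; first by split=> //; lia.
split; first by split=> //; lia.
do 2! split => //.
move=> j lt_j; rewrite !ifF; try lia.
exact: H.
Qed.

Lemma tokI x : tok (I :&: J) x = tok I x && tok J x.
Proof.
have x_n : x %% n < n by rewrite ltn_mod; lia.
by rewrite !(tok_in _ x_n) inE.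
Qed.

Lemma scan_gap_spec bit r (b : nat -> bool) i M :
  (bit = 5 /\ r = 10) \/ (bit = 6 /\ r = 13) -> M 3 = 1 -> M 18 = k ->
  M bit = b i -> gap_inv k b i (M r) (M r.+1) (M r.+2) ->
  let M' := den (scan_gap bit r) M in
  gap_inv k b i.+1 (M' r) (M' r.+1) (M' r.+2) /\
  (forall x, x \notin [:: 7; r; r.+1; r.+2] -> M' x = M x).
Proof.
move=> br E3 E18 Eb inv; rewrite /scan_gap /= Eb; case: (boolP (b i)) => bi; last first.
  have := gap_inv_miss inv bi; case: br => -[? ?]; subst bit r; rewrite /= /upd /= E3 => inv';
  split=> // x; rewrite !inE !negb_or => /and4P[_ /negbTE-> /negbTE-> _] //.
rewrite ?upd_eq E18; have := gap_inv_hit inv bi.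
case: ifP => _ inv'; case: br => -[? ?]; subst bit r; rewrite /= /upd /= E3;
  split=> // x; rewrite !inE !negb_or => /and4P[/negbTE n7 /negbTE n0 /negbTE n1 /negbTE n2];
  by rewrite n0 n1 ?n2 n7.
Qed.

Lemma scan_run_spec (b : nat -> bool) i M : M 3 = 1 -> M 18 = k -> M 5 + M 6 - 1 = b i ->
  run_inv k b i (M 16) (M 17) ->
  let M' := den scan_run M in
  run_inv k b i.+1 (M' 16) (M' 17) /\
  (forall x, x != 7 -> x != 16 -> x != 17 -> M' x = M x).
Proof.
move=> E3 E18 Eb inv.
pose Q (M1 : mem) := M1 7 = b i /\ (forall x, x != 7 -> M1 x = M x).
apply: (den_seqP (Q := Q) (P := fun M' => run_inv k b i.+1 (M' 16) (M' 17) /\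
  (forall x, x != 7 -> x != 16 -> x != 17 -> M' x = M x))) => [|M1 [E7 F]].
  by rewrite /Q /= /upd /= E3 Eb; split=> // x /negbTE->.
rewrite /= E7; case: (boolP (b i)) => bi /=.
  split; first by rewrite upd_eq upd_ne // F //; exact: run_inv_hit k0 inv bi.
  by move=> x n7 n16 _; rewrite upd_ne // F.
have := run_inv_miss inv bi; rewrite /upd /= !F // E3 E18.
case: ifP => _ inv'; rewrite /= ?F //; split=> // x /negbTE n7 /negbTE n16 /negbTE n17;
  by rewrite ?n17 n7 n16 F ?n7.
Qed.

Lemma scan_spec q p M : q %% n = 0 -> p < n -> scanning q p M ->
  scanning q p.+1 (den (Seq read_bits scan_body) M).
Proof.
move=> q0 lt_p [[E0 E1 E2] [[E3 E4 E18] [[E8 E9] [[HI HJ HR] H]]]].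
have tq (A : {set 'I_n}) : tok A p = tok A (q + p) by rewrite /tok -(modnDml q p n) q0.
have [HpI HpJ] := H p lt_p; rewrite !tq in HpI HpJ.
pose Q1 (M' : mem) := [/\ M' 5 = tok I (q + p), M' 6 = tok J (q + p) &
  forall x, x \notin [:: 5; 6; 7] -> M' x = M x].
apply: (den_seqP (Q := Q1)) => [|M1 [E5 E6 F1]].
  rewrite /Q1 /= /upd /= !(E0, E1) HpI ifF; last by lia.
  rewrite ifF; last by lia.
  by rewrite HpJ; split=> // x; rewrite !inE !negb_or => /and3P[/negbTE-> /negbTE-> /negbTE->].
pose Q2 (M' : mem) := [/\ M' 8 = cnt (tok I) (q + p).+1, M' 9 = cnt (tok J) (q + p).+1 &
  forall x, x \notin [:: 8; 9] -> M' x = M1 x].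
apply: (den_seqP (Q := Q2)) => [|M2 [E8' E9' F2]].
  rewrite /Q2 /= /upd /= E5 E6 !F1 // E8 E9 !cntS; split=> // x.
  by rewrite !inE !negb_or => /andP[/negbTE-> /negbTE->].
pose Q3 (M' : mem) := gap_inv k (tok I) (q + p).+1 (M' 10) (M' 11) (M' 12) /\
  forall x, x \notin [:: 7; 10; 11; 12] -> M' x = M2 x.
apply: (den_seqP (Q := Q3)) => [|M3 [HI' F3]].
  apply: scan_gap_spec; rewrite 5?F2 ?E5 5?F1 //; by left.
pose Q4 (M' : mem) := gap_inv k (tok J) (q + p).+1 (M' 13) (M' 14) (M' 15) /\
  forall x, x \notin [:: 7; 13; 14; 15] -> M' x = M3 x.
apply: (den_seqP (Q := Q4)) => [|M4 [HJ' F4]].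
  apply: scan_gap_spec; rewrite 5?F3 5?F2 ?E6 5?F1 //; by right.
pose Q5 (M' : mem) := run_inv k (tok (I :&: J)) (q + p).+1 (M' 16) (M' 17) /\
  forall x, x != 7 -> x != 16 -> x != 17 -> M' x = M4 x.
apply: (den_seqP (Q := Q5)) => [|M5 [HR' F5]].
  apply: scan_run_spec; rewrite 4?F4 4?F3 4?F2 ?E5 ?E6 4?F1 // tokI.
  by case: tok; case: tok.
have F x : x < 5 \/ 18 <= x -> M5 x = M x.
  by move=> Hx; rewrite F5 ?F4 ?F3 ?F2 ?F1 // ?inE; lia.
rewrite /scanning !addnS /= /upd /=; split; first by rewrite !F; [split; lia | lia..].
split; first by rewrite !F; [split; lia | lia..].
split; first by rewrite !F5 // !F4 // !F3.
split; first by split; rewrite // !F5 // !F4.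
by move=> j lt_j; rewrite !ifF; [rewrite !F; [exact: H | lia..] | lia..].
Qed.

(** The doublings outside [.+3] stem from [n + n] rounds of copying and from two passes; [.+3]
    charges to every round the loop overhead of two steps and the last test. *)
Definition cost (final : cmd) : nat :=
  (len setup).*2 + ((len copy_cell).*2.+3).*2 + (len (init k)).*2 + (len rewind).*2 +
  ((len (Seq read_bits scan_body)).*2.+3).*2 + (len final).*2.

Lemma decide_spec final T (b : Prop) : loopfree final -> cost final * n <= T ->
  (forall M, scanning n n M -> den final M 0 <= 1 /\ (den final M 0 = 1 <-> b)) ->
  decides_within (code 0 (decide k final)) T inp b.
Proof.
move=> lf le_T Hfinal; pose pre (M : mem) := M =1 inp.
have T1 := @triple_den pre (copied 0) setup isT setup_spec.
have T2 := @triple_while copied 5 copy_cell (len copy_cell).*2 (n + n).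
have {T2}T2 := T2 (fun i M H => let: conj _ (conj (And3 _ _ E) _) := H in E).
have {T2}T2 := T2 (fun i lt_i => @triple_den _ _ copy_cell isT (fun M => @copy_spec i M lt_i)).
have T3 := @triple_den _ _ (init k) isT init_spec.
pose tb := (len (Seq read_bits scan_body)).*2.
have Tpass q : q %% n = 0 -> triple (scanning q 0) pass (n * tb.+2).+1 (scanning q n).
  move=> q0; apply: (@triple_while (scanning q) 4 _ tb n).
    by move=> i M [_ [[_ E _] _]].
  by move=> i lt_i; apply: triple_den => // M; apply: scan_spec.
have T4 := Tpass 0 (mod0n n).
have T5 := @triple_den _ _ rewind isT rewind_spec.
have T6 := Tpass n (modnn n).
have T7 := @triple_den _ (fun M => M 0 <= 1 /\ (M 0 = 1 <-> b)) final lf Hfinal.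
have Tall := triple_seq T1 (triple_seq T2 (triple_seq T3 (triple_seq T4
  (triple_seq T5 (triple_seq T6 T7))))).
apply: (triple_decides Tall) => //; apply: leq_trans le_T.
rewrite /cost -/tb => {T1 T2 T3 Tpass T4 T5 T6 T7 Tall}.
move: tb (len setup).*2 (len copy_cell).*2 (len (init k)).*2 (len rewind).*2 (len final).*2.
move=> t t1 t2 t3 t5 t7.
have le x : x <= x * n by rewrite leq_pmulr //; lia.
have := (le t1, le t3, le t5, le t7).
rewrite -!addnn !mulnDl !mulnS [n * t]mulnC [n * t2]mulnC.
rewrite -[t2.+3]addn3 -[t.+3]addn3 !mulnDl => -[[[? ?] ?] ?].
lia.
Qed.

Lemma cnt_double (A : {set 'I_n}) : cnt (tok A) (n + n) = #|A| + #|A|.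
Proof. by rewrite (proj1 (height_cnt A)) cnt_card. Qed.

End Run.

(** * Evaluating the criteria on the final counters *)

Definition if_le (a b : nat) (c1 c2 : cmd) : cmd := Seq (Ins (Defs.Sub 7 a b)) (Ifz 7 c1 c2).

(** Serves to multiply by the fixed [k] through unrolled additions. *)
Definition times (m : nat) (i : instr) : cmd := iter m (Seq (Ins i)) Skip.

Definition ret (v : nat) : cmd := Ins (Const 0 v).

(* Register 7 is scratch space for comparisons. *)
Definition agree (R M : mem) : Prop := forall x, x != 7 -> M x = R x.

Lemma den_if_le R (P : mem -> Prop) a b c1 c2 M :
  a != 7 -> b != 7 -> agree R M ->
  (R a <= R b -> forall M', agree R M' -> P (den c1 M')) ->
  (R b < R a -> forall M', agree R M' -> P (den c2 M')) ->
  P (den (if_le a b c1 c2) M).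
Proof.
move=> a7 b7 RM H1 H2; rewrite /if_le /= upd_eq !RM // subn_eq0.
have RM' v : agree R (upd M 7 v) by move=> x x7; rewrite upd_ne // RM.
by case: leqP => H; [apply: H1 | apply: H2].
Qed.

Lemma den_ifz R (P : mem -> Prop) a c1 c2 M :
  a != 7 -> agree R M ->
  (R a = 0 -> P (den c1 M)) -> (R a <> 0 -> P (den c2 M)) -> P (den (Ifz a c1 c2) M).
Proof. by move=> a7 RM H1 H2; rewrite /= RM //; case: eqP. Qed.

Lemma den_times m d s M : d != s ->
  den (times m (Add d d s)) M d = M d + m * M s /\
  forall x, x != d -> den (times m (Add d d s)) M x = M x.
Proof.
move=> ds; elim: m M => [|m IH] M; first by rewrite addn0.
have [Ed Ex] := IH (upd M d (M d + M s)).
rewrite /= Ed !upd_eq upd_ne 1?eq_sym // mulSn addnA; split=> // x xd.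
by rewrite Ex // upd_ne.
Qed.

Lemma loopfree_times m i : basic i -> loopfree (times m i).
Proof. by move=> bi; elim: m => //= m ->; rewrite bi. Qed.

(** After two passes registers 8 and 9 hold twice the sizes, so [k * #|I|] is compared with [n]
    through [2 * n], and [#|I|] with 1 through 2. *)
Definition jump_final (k : nat) : cmd :=
  Seq (block [:: Const 5 0; Add 6 1 1; Const 19 2]) (Seq (times k (Add 5 5 8))
  (if_le 8 9 (if_le 9 8
    (if_le 5 6 (if_le 6 5 (if_le 8 19 (ret 1) (ret 0)) (ret 1)) (ret 1)) (ret 0)) (ret 0))).

Lemma jump_final_spec n u k (I J : {set 'I_n}) M :
  2 < n -> scanning u k I J n n M -> den (jump_final k) M 0 = jump_ok k I J.
Proof.
move=> n3 [[_ E1 _] [_ [[E8 E9] _]]].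
rewrite !cnt_double in E8 E9.
pose P (M' : mem) := M' 0 = jump_ok k I J :> nat.
have yes M' : jump_ok k I J -> P (den (ret 1) M') by rewrite /P /= upd_eq => ->.
have no M' : ~~ jump_ok k I J -> P (den (ret 0) M') by rewrite /P /= upd_eq => /negbTE->.
pose Q (M' : mem) := [/\ M' 5 = 0, M' 6 = n + n & M' 19 = 2] /\ M' 8 = M 8 /\ M' 9 = M 9.
apply: (den_seqP (Q := Q) (P := P)) => [|M' [[H5 H6 H19] [H8 H9]]].
  by rewrite /Q /= /upd /= E1.
pose Q' (M1 : mem) := M1 5 = M' 5 + k * M' 8 /\ (forall x, x != 5 -> M1 x = M' x).
apply: (den_seqP (Q := Q') (P := P)) => [|R [R5 RM]].
  exact: den_times.
have R8 : R 8 = #|I| + #|I| by rewrite RM // H8.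
have R9 : R 9 = #|J| + #|J| by rewrite RM // H9.
have R6 : R 6 = n + n by rewrite RM // H6.
have R19 : R 19 = 2 by rewrite RM // H19.
have {}R5 : R 5 = k * #|I| + k * #|I| by rewrite R5 H5 H8 E8 mulnDr.
apply: (den_if_le (R := R) (P := P)) => // [le1 M1 A1|lt1 M1 A1];
  last by apply: no; rewrite /jump_ok; lia.
apply: (den_if_le (R := R) (P := P)) => // {A1 M1} [le2 M1 A1|lt2 M1 A1];
  last by apply: no; rewrite /jump_ok; lia.
apply: (den_if_le (R := R) (P := P)) => // {A1 M1} [le3 M1 A1|lt3 M1 A1];
  last by apply: yes; rewrite /jump_ok; lia.
apply: (den_if_le (R := R) (P := P)) => // {A1 M1} [le4 M1 A1|lt4 M1 A1];
  last by apply: yes; rewrite /jump_ok; lia.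
have kn : k * #|I| = n by lia.
have I0 : 0 < #|I| by case: #|I| kn; rewrite ?muln0; lia.
by apply: (den_if_le (R := R) (P := P)) => // {A1 M1} [le5 M1 A1|lt5 M1 A1];
  [apply: yes | apply: no]; rewrite /jump_ok; lia.
Qed.

Definition try_remove (flag size : nat) (c : cmd) : cmd :=
  Ifz flag (if_le 10 size (ret 0) c) c.

(** Registers 10 and 11 now hold [2 * u], for comparison with the doubled sizes, and [u - 1]; the
    flags 12, 15 and 17 are those left by the scan. *)
Definition tar_final (k : nat) : cmd :=
  Seq (block [:: Const 5 0; Add 10 2 2; Defs.Sub 11 2 3; Const 19 2])
  (Seq (times k (Add 5 5 11))
  (if_le 8 10 (if_le 9 10 (if_le 18 1
    (Ifz 17 (ret 1) (try_remove 12 8 (try_remove 15 9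
      (if_le 5 1 (if_le 1 5 (if_le 2 19 (ret 1) (ret 0)) (ret 1)) (ret 1)))))
    (ret 1)) (ret 0)) (ret 0))).

Definition answers (b : Prop) (M : mem) : Prop := M 0 <= 1 /\ (M 0 = 1 <-> b).

Lemma den_ret_yes b M : b -> answers b (den (ret 1) M).
Proof. by rewrite /answers /= upd_eq. Qed.

Lemma den_ret_no b M : ~ b -> answers b (den (ret 0) M).
Proof. by rewrite /answers /= upd_eq. Qed.

Lemma try_remove_spec R (P : mem -> Prop) flag size (u s : nat) (q : Prop) c M :
  flag != 7 -> size != 7 -> agree R M -> R 10 = u + u -> R size = s + s -> s <= u ->
  R flag <= 1 -> (R flag = 1 <-> q) ->
  (s < u \/ q -> forall M', agree R M' -> P (den c M')) ->
  (~ (s < u \/ q) -> forall M', agree R M' -> P (den (ret 0) M')) ->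
  P (den (try_remove flag size c) M).
Proof.
move=> f7 s7 RM R10 Rs le_su f1 Hq Hyes Hno; rewrite /try_remove.
apply: (den_ifz (R := R) (P := P)) => // [f0|f0]; last first.
  by apply: Hyes RM; right; apply/Hq; lia.
have nq : ~ q by move/Hq; rewrite f0.
apply: (den_if_le (R := R) (P := P)) => //; rewrite R10 Rs => H.
  by apply: Hno => -[|//]; lia.
by apply: Hyes; left; lia.
Qed.

Lemma tar_final_spec n u k (I J : {set 'I_n}) M :
  2 < n -> 1 < k -> 0 < u ->
  is_kpvc (@cycle_adj n) k I -> is_kpvc (@cycle_adj n) k J -> I != J ->
  scanning u k I J n n M ->
  answers (TAR_reach (@cycle_adj n) k u I J) (den (tar_final k) M).
Proof.
move=> n3 k2 u0 kI kJ neqIJ [[_ E1 E2] [[E3 _ E18] [[E8 E9] [[HI HJ HR] _]]]].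
have reachP := TAR_reachP n3 k2 u0 kI kJ neqIJ.
set reach := TAR_reach _ _ _ _ _ in reachP *; pose P := answers reach.
rewrite !cnt_double in E8 E9.
pose Q (M' : mem) := [/\ M' 5 = 0, M' 10 = u + u, M' 11 = u.-1 & M' 19 = 2] /\
  (forall x, x \notin [:: 5; 10; 11; 19] -> M' x = M x).
apply: (den_seqP (Q := Q) (P := P)) => [|M' [[H5 H10 H11 H19] F]].
  rewrite /Q /= /upd /= E2 E3 subn1; split=> // x.
  by rewrite !inE !negb_or => /and4P[/negbTE-> /negbTE-> /negbTE-> /negbTE->].
pose Q' (M1 : mem) := M1 5 = M' 5 + k * M' 11 /\ (forall x, x != 5 -> M1 x = M' x).
apply: (den_seqP (Q := Q') (P := P)) => [|R [R5 RM]]; first exact: den_times.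
have {}R5 : R 5 = k * u.-1 by rewrite R5 H5 H11.
have R10 : R 10 = u + u by rewrite RM.
have R19 : R 19 = 2 by rewrite RM.
have R8 : R 8 = #|I| + #|I| by rewrite RM // F.
have R9 : R 9 = #|J| + #|J| by rewrite RM // F.
have R1 : R 1 = n by rewrite RM // F.
have R2 : R 2 = u by rewrite RM // F.
have R18 : R 18 = k by rewrite RM // F.
have R12 : R 12 = M 12 by rewrite RM // F.
have R15 : R 15 = M 15 by rewrite RM // F.
have R17 : R 17 = M 17 by rewrite RM // F.
move=> {H5 H10 H11 H19 F RM Q Q'}.
have A0 : agree R R by [].
apply: (den_if_le (R := R) (P := P)) => //; rewrite R8 R10 => lI M1 A1; last first.
  by apply: den_ret_no => /reachP[]; lia.
apply: (den_if_le (R := R) (P := P)) => //; rewrite R9 R10 => lJ {A1}M1 A1; last first.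
  by apply: den_ret_no => /reachP[]; lia.
have Iu : #|I| <= u by lia.
have Ju : #|J| <= u by lia.
apply: (den_if_le (R := R) (P := P)) => //; rewrite R18 R1 => le_kn {A1}M1 A1; last first.
  by apply: den_ret_yes; apply/reachP; split=> //; apply: Or31.
have [_ _ _ g1 HG] := HR; rewrite has_gapP // in HG.
apply: (den_ifz (R := R) (P := P)) => //; rewrite R17 => G.
  apply: den_ret_yes; apply/reachP; split=> //; apply: Or32.
  by case: (cov_or_gap n3 k2 le_kn (I :&: J)) => // /(has_gapP n3 k2 le_kn)/HG; rewrite G.
have ncov : ~ cov k (tok (I :&: J)) by apply/HG; lia.
have [_ _ fI1 HfI] := HI; rewrite has_threeP // in HfI.
have [_ _ fJ1 HfJ] := HJ; rewrite has_threeP // in HfJ.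
rewrite -R12 in fI1 HfI; rewrite -R15 in fJ1 HfJ.
apply: (try_remove_spec (P := P) _ _ A1 R10 R8 Iu fI1 HfI) => // nI {A1}M1 A1; last first.
  by apply: den_ret_no => /reachP[_ _ [|//|[]//]]; lia.
apply: (try_remove_spec (P := P) _ _ A1 R10 R9 Ju fJ1 HfJ) => // nJ {A1}M1 A1; last first.
  by apply: den_ret_no => /reachP[_ _ [|//|[]//]]; lia.
have yes : ~ (k * u.-1 = n /\ 2 < u) -> reach.
  by move=> H; apply/reachP; split=> //; apply: Or33.
apply: (den_if_le (R := R) (P := P)) => //; rewrite R5 R1 => le5 {A1}M1 A1; last first.
  by apply: den_ret_yes; apply: yes; lia.
apply: (den_if_le (R := R) (P := P)) => //; rewrite R5 R1 => le5' {A1}M1 A1; last first.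
  by apply: den_ret_yes; apply: yes; lia.
apply: (den_if_le (R := R) (P := P)) => //; rewrite R2 R19 => le2 {A1}M1 A1.
  by apply: den_ret_yes; apply: yes; lia.
by apply: den_ret_no => /reachP[_ _ [|//|[_ _ []]]]; lia.
Qed.

Theorem theorem10 :
  forall k : nat, 2 <= k ->
  (* TJ : O(n) *)
  (exists (P : program) (c : nat),
     forall (n : nat) (I J : {set 'I_n}), 3 <= n ->
       is_kpvc (@cycle_adj n) k I -> is_kpvc (@cycle_adj n) k J -> I != J ->
       decides_within P (c * n) (encode n 0 I J) (TJ_reach (@cycle_adj n) k I J)) /\
  (* TAR(u) : O(n) *)
  (exists (P : program) (c : nat),
     forall (n u : nat) (I J : {set 'I_n}), 3 <= n -> 0 < u ->
       is_kpvc (@cycle_adj n) k I -> is_kpvc (@cycle_adj n) k J -> I != J ->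
       decides_within P (c * n) (encode n u I J) (TAR_reach (@cycle_adj n) k u I J)) /\
  (* TS : O(n^2) *)
  (exists (P : program) (c : nat),
     forall (n : nat) (I J : {set 'I_n}), 3 <= n ->
       is_kpvc (@cycle_adj n) k I -> is_kpvc (@cycle_adj n) k J -> I != J ->
       decides_within P (c * n ^ 2) (encode n 0 I J) (TS_reach (@cycle_adj n) k I J)).
Proof.
move=> k k2; have k0 : 0 < k by exact: ltnW.
have lf_jump : loopfree (jump_final k) by rewrite /= loopfree_times.
have jump n (I J : {set 'I_n}) T (b : Prop) : 2 < n -> (b <-> jump_ok k I J) ->
    cost k (jump_final k) * n <= T ->
    decides_within (code 0 (decide k (jump_final k))) T (encode n 0 I J) b.
  move=> n3 Hb le_T; apply: (decide_spec n3 k0 lf_jump le_T) => M /(jump_final_spec n3)->.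
  by rewrite Hb; case: jump_ok.
split; [|split].
- exists (code 0 (decide k (jump_final k))), (cost k (jump_final k)) => n I J n3 kI kJ neq.
  by apply: jump => //; apply: TJ_reachP.
- exists (code 0 (decide k (tar_final k))), (cost k (tar_final k)) => n u I J n3 u0 kI kJ neq.
  apply: (decide_spec n3 k0 _ (leqnn _)) => [|M]; first by rewrite /= loopfree_times.
  exact: tar_final_spec.
(* The criteria for sliding and jumping coincide, so the same linear-time program serves, and its
   bound is at most quadratic. *)
- exists (code 0 (decide k (jump_final k))), (cost k (jump_final k)) => n I J n3 kI kJ neq.
  apply: jump => //; first exact: TS_reachP.
  by rewrite leq_mul2l leq_pmulr ?orbT //; apply: ltnW (ltnW n3).
Qed.
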